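(* Fix $p$ with $1\le p\le\infty$ and let $\alpha_p$ be the area of the unit disk $\{x\in\mathbb{R}^2:\|x\|_p\le 1\}$. Let $\mathcal{G}(n,r)$ be the random geometric graph (with respect to the $\ell_p$ norm) on $n$ points. Then for every fixed $\epsilon>0$: (1) if $r=\sqrt{\frac{\log n}{(\alpha_p+\epsilon)n}}$, then asymptotically almost surely $\mathcal{G}(n,r)$ contains no Hamiltonian cycle; (2) if $r=\sqrt{\frac{\log n}{(\alpha_p-\epsilon)n}}$ (with $\epsilon<\alpha_p$), then asymptotically almost surely $\mathcal{G}(n,r)$ contains a Hamiltonian cycle. In particular, the property of containing a Hamiltonian cycle has a sharp threshold at $r=\sqrt{\frac{\log n}{\alpha_p n}}$.
   Context: The random geometric graph $\mathcal{G}(n,r)$ in the $\ell_p$ norm is obtained by placing $n$ points independently and uniformly at random in the unit square $[0,1]^2$ and joining two distinct points by an edge iff their $\ell_p$ distance is at most $r$. A Hamiltonian cycle is a simple cycle visiting every vertex exactly once. ''Asymptotically almost surely'' (a.a.s.) means with probability tending to $1$ as $n\to\infty$. $\log$ denotes the natural logarithm. *)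

(* Defs.v *)
From HB Require Import structures.
From mathcomp Require Import all_boot all_order all_algebra.
From mathcomp Require Import all_classical all_reals all_analysis.

Set Implicit Arguments.
Unset Strict Implicit.
Unset Printing Implicit Defensive.

Import Order.TTheory GRing.Theory Num.Theory.
Import numFieldNormedType.Exports.

Local Open Scope classical_set_scope.
Local Open Scope ring_scope.

(* The sigma-algebra is the product of the Borel sigma-algebras of R. *)
Notation plane R := (measurableTypeR R * measurableTypeR R)%type.

Definition area {R : realType} : set (plane R) -> \bar R :=
  (@lebesgue_measure R \x @lebesgue_measure R)%E.

Definition unit_square {R : realType} : set (plane R) :=
  [set x | (0 <= x.1 <= 1) && (0 <= x.2 <= 1)].

(* Only meaningful for 1 <= p <= +oo; the value at p = -oo is a dummy. *)
Definition lp_norm (R : realType) (p : \bar R) (x : plane R) : R :=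
  match p with
  | q%:E => (`|x.1| `^ q + `|x.2| `^ q) `^ q^-1
  | +oo%E => Num.max `|x.1| `|x.2|
  | -oo%E => 0
  end.

Definition lp_dist (R : realType) (p : \bar R) (x y : plane R) : R :=
  lp_norm p (x.1 - y.1, x.2 - y.2).

Definition lp_ball_area (R : realType) (p : \bar R) : R :=
  fine (area [set x : plane R | lp_norm p x <= 1]).

Definition uniform_in_unit_square (R : realType) (d : measure_display)
    (T : measurableType d) (P : probability T R) (X : {RV P >-> plane R}) :=
  forall A : set (plane R), measurable A ->
    distribution P X A = area (A `&` unit_square).

Definition mutually_independent (R : realType) (d d' : measure_display)
    (T : measurableType d) (T' : measurableType d') (P : probability T R)
    (I : finType) (X : I -> {RV P >-> T'}) :=
  forall (J : {set I}) (A : I -> set T'), (forall i, measurable (A i)) ->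
    P (\bigcap_(i in [set` J]) (X i @^-1` A i)) =
    (\prod_(i in J) P (X i @^-1` A i))%E.

Definition iid_uniform_points (R : realType) (d : measure_display)
    (T : measurableType d) (P : probability T R) (n : nat)
    (X : 'I_n -> {RV P >-> plane R}) :=
  (forall i, uniform_in_unit_square (X i)) /\ mutually_independent X.

(* The vertices are the indices of the points, so that coinciding points (an
   event of probability 0) are still distinct vertices. *)
Definition geometric_graph (R : realType) (p : \bar R) (r : R) (n : nat)
    (x : 'I_n -> plane R) : rel 'I_n :=
  fun i j => (i != j) && (lp_dist p (x i) (x j) <= r).

(* A cycle has at least three vertices: MathComp's [ucycle] also accepts the
   empty sequence, loops, and single edges traversed back and forth. *)
Definition hamiltonian (V : finType) (e : rel V) : Prop :=
  exists c : seq V, [/\ (2 < size c)%N, ucycle e c & forall v, v \in c].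

Definition aas (R : realType) (d : nat -> measure_display)
    (T : forall n, measurableType (d n)) (P : forall n, probability (T n) R)
    (E : forall n, set (T n)) : Prop :=
  P n (E n) @[n --> \oo] --> 1%E.

(* Sharp threshold of an increasing graph property Q in a random graph model
   G r n depending on a radius r. *)
Definition sharp_threshold (R : realType) (d : nat -> measure_display)
    (T : forall n, measurableType (d n)) (P : forall n, probability (T n) R)
    (G : R -> forall n, T n -> rel 'I_n)
    (Q : forall n, rel 'I_n -> Prop) (r0 : nat -> R) : Prop :=
  forall (delta : R) (r : nat -> R), 0 < delta ->
    ((\forall n \near \oo, r n <= (1 - delta) * r0 n) ->
       aas P (fun n => [set w | ~ Q n (G (r n) n w)])) /\
    ((\forall n \near \oo, (1 + delta) * r0 n <= r n) ->
       aas P (fun n => [set w | Q n (G (r n) n w)])).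

(* The radius at which n * (a * r ^ 2) = ln n. *)
Definition rgg_radius (R : realType) (a : R) (n : nat) : R :=
  Num.sqrt (ln n%:R / (a * n%:R)).

(* Main.v *)
Require Import Defs.
From HB Require Import structures.
From mathcomp Require Import all_boot all_order all_algebra zify ring lra.

Set Implicit Arguments.
Unset Strict Implicit.
Unset Printing Implicit Defensive.

(* Cut the square into m x m cells of side about r / rho, for a large constant rho, and
   record only the cell of each point: this gives n independent uniform cells.

   Below the threshold, the second moment method applied to the pairs (cell of a sparse
   sublattice, point alone in the disk of radius r around this cell) yields an isolated
   vertex.

   Above the threshold, call a cell dense if it contains at least a large constant number of
   points.  By a union bound, a.a.s. every window of constant size contains sparse cells of
   total area less than alpha r^2 (one half, resp. one quarter, of this near a side, resp. a
   corner, of the square).  In particular each window has rows and columns consisting of dense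
   cells, and all these rows and columns lie in a single component of the dense cells.  A set
   of cells that avoids this component and contains all its own dense neighbours would have
   only sparse cells to the right of its rightmost cell and to the left of its leftmost cell
   within distance r, which is too many.  So the dense cells are connected and each cell has
   a dense neighbour.  A Hamiltonian cycle is then built by inserting the points of one cell
   at a time between two consecutive points that lie in a common dense cell. *)

(** * Connectivity of the dense cells of a grid *)

(** Replacing points by their cells changes the radius, measured in cells, by at most 4. With rho =
    4 / t the counts of cells given by [near] and [touch] therefore differ from the area of the disk
    only by factors close to 1, and t is chosen so that the gap between alpha and the given constant
    absorbs them. The obstacle above the threshold is the boundary, where the disk is cut to a half
    or a quarter. Sparse cells are therefore counted by quadrants: [q] displacements positive in
    both coordinates make a quarter of a disk, and having [q] sparse cells costs a factor E, about
    n^(-(1+t)/4). There are m^2 <= n cells in all, of order m near the sides and boundedly many near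
    the corners, so that m^2 E^4, m E^2 and E all tend to 0. The number of points that makes a cell
    dense exceeds the number of neighbours of a cell: each insertion next to a dense cell uses up
    one consecutive pair of its points, and the cell may have to serve all its neighbours. As this
    number is a constant, the probability of sparseness pays for it only by a constant factor. *)

(** With truncated subtraction at most one summand is nonzero, so this is |a - b| in a form suited
    to [lia]. *)
Definition ndist (a b : nat) : nat := (a - b) + (b - a).

(** Pigeonhole. It serves to find a row or column of a window that meets none of its sparse
    cells. *)
Lemma exists_unhit (T : finType) (S : {set T}) (m lo hi : nat) (f : T -> 'I_m) :
  hi <= m -> #|S| < hi - lo ->
  exists2 i : 'I_m, lo <= i < hi & forall v, v \in S -> f v != i.
Proof.
move=> him hS.
pose W := [set i : 'I_m | lo <= i < hi].
have cW : hi - lo <= #|W|.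
  have inj : injective (fun k : 'I_(hi - lo) =>
      Ordinal (n := m) (m := lo + k) ltac:(have := ltn_ord k; lia)).
    by move=> k k' [] /addnI; apply: val_inj.
  rewrite -[X in X <= _]card_ord -(card_imset _ inj); apply: subset_leq_card.
  apply/fintype.subsetP => i /imsetP[k _ ->]; rewrite !inE /=.
  have := ltn_ord k; lia.
have : 0 < #|W :\: (f @: S)|.
  rewrite cardsD subn_gt0; apply: leq_ltn_trans (leq_trans hS cW).
  apply: leq_trans (leq_imset_card f S); apply: subset_leq_card; exact: subsetIr.
case/card_gt0P => i; rewrite !inE => /andP[hn hi']; exists i => // v vS.
by apply: contra hn => /eqP <-; apply: imset_f.
Qed.

Section GridConnectivity.
Variables (m q N L : nat) (nr : rel nat) (D : {set 'I_m * 'I_m}).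
Notation cell := ('I_m * 'I_m)%type.

(** Adjacency depends only on the two coordinate distances, hence is invariant under reflections. It
    is used with [near] and with [touch]. *)
Definition cell_adj (nr : rel nat) : rel ('I_m * 'I_m) :=
  fun u v => nr (ndist u.1 v.1) (ndist u.2 v.2).

Definition dense_adj : rel cell := fun u v => [&& u \in D, v \in D & cell_adj nr u v].

Definition box (L : nat) (c : 'I_m * 'I_m) : {set cell} :=
  [set v : cell | (ndist c.1 v.1 <= L) && (ndist c.2 v.2 <= L)].

(* Number of the two sides of [i] on which the window of radius [L] is not cut off
   by the edge of the grid. *)
Definition nopen (m L i : nat) : nat := (L <= i) + (i + L < m).

Hypothesis nr_mono : forall a b a' b', a' <= a -> b' <= b -> nr a b -> nr a' b'.
Hypothesis nr10 : nr 1 0.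
Hypothesis nr01 : nr 0 1.
(** The displacements counted here form a quarter of the disk of [nr]. By [few], a window has less
    than [q] sparse cells for each quadrant that is not cut off, hence less than [4 * q]. Two
    windows have less than [8 * q], and [hL] leaves room for a line that avoids them all. *)
Hypothesis hq : q <= #|[set ab : 'I_N * 'I_N | nr ab.1.+1 ab.2.+1]|.
Hypothesis hL : 8 * q < L.
Hypothesis hm : 2 * L < m.
Hypothesis few : forall c : cell,
  #|box L c :\: D| < q * nopen m L c.1 * nopen m L c.2.

Lemma nopen_le2 (i : nat) : nopen m L i <= 2.
Proof. by rewrite /nopen; case: (L <= i); case: (_ < m). Qed.

Lemma few4 c : #|box L c :\: D| < 4 * q.
Proof.
apply: leq_trans (few c) _; have := nopen_le2 c.1; have := nopen_le2 c.2.
set x := nopen _ _ _; set y := nopen _ _ _ => hx hy.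
by have := leq_mul (leq_mul (leqnn q) hy) hx; lia.
Qed.

Definition clean_col (c : cell) (i : 'I_m) :=
  [forall v : cell, (v \in box L c) ==> (v.1 == i) ==> (v \in D)].
Definition clean_row (c : cell) (j : 'I_m) :=
  [forall v : cell, (v \in box L c) ==> (v.2 == j) ==> (v \in D)].

Lemma clean_colP c i : reflect (forall v, v \in box L c :\: D -> v.1 != i) (clean_col c i).
Proof.
apply: (iffP forallP) => H v.
  by rewrite !inE => /andP[vD vb]; have := H v; rewrite inE vb /= (negbTE vD); case: eqP.
apply/implyP => vb; apply/implyP => vi; case: (boolP (v \in D)) => // vD.
by have := H v; rewrite inE vb vD vi => /(_ isT).
Qed.

Lemma clean_rowP c i : reflect (forall v, v \in box L c :\: D -> v.2 != i) (clean_row c i).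
Proof.
apply: (iffP forallP) => H v.
  by rewrite !inE => /andP[vD vb]; have := H v; rewrite inE vb /= (negbTE vD); case: eqP.
apply/implyP => vb; apply/implyP => vi; case: (boolP (v \in D)) => // vD.
by have := H v; rewrite inE vb vD vi => /(_ isT).
Qed.

(** The clean lines of the window. Crosses are nonempty, linked through dense cells, and those of
    neighbouring windows overlap; so all of them lie in one component. *)
Definition cross (c : cell) : {set cell} :=
  [set g in box L c | clean_col c g.1 || clean_row c g.2].

Lemma cross_dense c g : g \in cross c -> g \in D.
Proof.
rewrite inE => /andP[gb /orP[] /forallP/(_ g)]; by rewrite gb eqxx.
Qed.

Lemma col_window (c : cell) lo hi : hi <= m -> 4 * q <= hi - lo ->
  exists2 i : 'I_m, lo <= i < hi & clean_col c i.
Proof.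
move=> him hw; have [i hi' H] := exists_unhit (fun v : cell => v.1) him (leq_trans (few4 c) hw).
by exists i => //; apply/clean_colP.
Qed.

Lemma row_window (c : cell) lo hi : hi <= m -> 4 * q <= hi - lo ->
  exists2 i : 'I_m, lo <= i < hi & clean_row c i.
Proof.
move=> him hw; have [i hi' H] := exists_unhit (fun v : cell => v.2) him (leq_trans (few4 c) hw).
by exists i => //; apply/clean_rowP.
Qed.

(* [lo, hi) is the gap around [x] delimited by clean lines; on a closed side the
   gap extends to the edge of the grid. *)
Definition gap (clean : pred 'I_m) (x : 'I_m) (lo hi : nat) :=
  [/\ lo <= x < hi, hi <= m, (x < lo + L) && (hi <= x + L),
      (L <= x -> exists2 i : 'I_m, clean i & lo = i.+1) &
      (x + L < m -> exists2 i : 'I_m, clean i & hi = i :> nat)].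

Lemma gapP (clean : pred 'I_m) (x : 'I_m) :
  (forall lo hi, hi <= m -> 4 * q <= hi - lo -> exists2 i : 'I_m, lo <= i < hi & clean i) ->
  exists lo hi, gap clean x lo hi.
Proof.
move=> H.
have [lo [lo1 lo2 lo3]] : exists lo, [/\ lo <= x, x < lo + L &
    (L <= x -> exists2 i : 'I_m, clean i & lo = i.+1)].
  case: (leqP L x) => hx; last by exists 0; split => //; lia.
  have [|i hi ci] := H (x - L) x (ltnW (ltn_ord x)); first lia.
  by exists i.+1; split; [lia|lia|exists i].
have [hi [hi1 hi2 hi3 hi4]] : exists hi, [/\ x < hi, hi <= m, hi <= x + L &
    (x + L < m -> exists2 i : 'I_m, clean i & hi = i :> nat)].
  case: (ltnP (x + L) m) => hx; last first.
    by exists m; split => //; lia.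
  have [||i hi ci] := H x.+1 (x + L).+1; [lia|lia|].
  by exists i; split; [lia|lia|lia|exists i].
by exists lo, hi; split => //; lia.
Qed.

(* Moving by [a] in the direction [s]; the default value is never used. *)
Definition shift (s : bool) (x : 'I_m) (a : nat) : 'I_m :=
  insubd x (if s then x + a else x - a).

Definition beyond (s : bool) (x y : nat) := if s then x < y else y < x.

(** The displacements counted by [hq], reflected according to [s] and [t], yield distinct cells; the
    first premise keeps these inside the grid. *)
Lemma quadrant_card (s t : bool) (u : cell) (Z : {set cell}) :
  (forall a b, nr a.+1 b.+1 ->
     (if s then u.1 + a.+1 < m else a.+1 <= u.1) /\
     (if t then u.2 + b.+1 < m else b.+1 <= u.2)) ->
  (forall v, cell_adj nr u v -> beyond s u.1 v.1 -> beyond t u.2 v.2 -> v \in Z) ->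
  q <= #|[set v in Z | beyond s u.1 v.1 && beyond t u.2 v.2]|.
Proof.
move=> hr hZ; apply: (leq_trans hq).
have sv (s' : bool) (x : 'I_m) (a : nat) : (if s' then x + a.+1 < m else a.+1 <= x) ->
   (shift s' x a.+1 = (if s' then x + a.+1 else x - a.+1) :> nat).
  rewrite /shift val_insubd; case: s' => h; first by rewrite h.
  by rewrite ifT //; have := ltn_ord x; lia.
pose f (ab : 'I_N * 'I_N) : cell := (shift s u.1 ab.1.+1, shift t u.2 ab.2.+1).
rewrite -(@card_in_imset _ _ f) => [|[a b] [a' b']].
  apply: subset_leq_card; apply/fintype.subsetP => v /imsetP[[a b]].
  rewrite inE /= => hab ->; have [h1 h2] := hr _ _ hab.
  have e1 := sv _ _ _ h1; have e2 := sv _ _ _ h2.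
  have b1 : beyond s u.1 (f (a, b)).1 by rewrite /beyond /f /= e1; case: (s) h1; lia.
  have b2 : beyond t u.2 (f (a, b)).2 by rewrite /beyond /f /= e2; case: (t) h2; lia.
  rewrite inE b1 b2 !andbT; apply: hZ => //; rewrite /cell_adj /f /= e1 e2.
  by apply: nr_mono hab; rewrite /ndist; case: (s) h1; case: (t) h2; lia.
rewrite !inE /= => hab hab' [] /(congr1 val) /= e1 /(congr1 val) /= e2.
move: e1 e2.
have [h1 h2] := hr _ _ hab; have [h1' h2'] := hr _ _ hab'.
rewrite !sv // => e1 e2; congr (_, _); apply: val_inj => /=.
  by case: (s) h1 h1' e1; lia.
by case: (t) h2 h2' e2; lia.
Qed.

(* Here U is a union of components of the dense cells, or a single sparse cell without
   dense neighbours. *)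
Lemma cross_unavoidable (c : cell) (U : {set cell}) : c \in U ->
  (forall u v, u \in U -> cell_adj nr u v -> v \in D -> v \in U) ->
  (forall u g, u \in U -> g \in cross c -> ~~ cell_adj nr u g) -> False.
Proof.
move=> cU closed ncross.
have [xl [xh [xc xm xlh xlo xhi]]] := gapP c.1 (col_window c).
have [yl [yh [yc ym ylh ylo yhi]]] := gapP c.2 (row_window c).
pose G := [set u in U | (xl <= u.1 < xh) && (yl <= u.2 < yh)].
have cG : c \in G by rewrite inE cU xc yc.
have Gbox (u : cell) : (xl <= u.1 < xh) && (yl <= u.2 < yh) -> u \in box L c.
  by rewrite inE /ndist; lia.
have GP (u : cell) : u \in G -> u \in U /\ (xl <= u.1 < xh) && (yl <= u.2 < yh).
  by rewrite inE => /andP[].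
(* If a move from [G] could reach the clean line that bounds the gap, then by [nr_mono] its origin
   would be adjacent to the cell of this line level with it, which belongs to the cross. *)
have mvx s (u : cell) a b : u \in G -> nr a b ->
    (if s then c.1 + L < m else L <= c.1) ->
    if s then u.1 + a < xh else xl + a <= u.1.
  move=> /GP[uU hu] hab hs.
  case: s hs => hs.
    have [i ci ei] := xhi hs; rewrite ltnNge; apply/negP => hle.
    have := ncross u (i, u.2) uU; rewrite inE [clean_col _ _]ci /= andbT.
    rewrite inE /= => H; have /H : (ndist c.1 i <= L) && (ndist c.2 u.2 <= L).
      by move: hu xlh ylh xc ei; clear; rewrite /ndist; lia.
    move/negP; apply; apply: nr_mono hab => /=; move: hu ei hle; clear;
      by rewrite /ndist; lia.
  have [i ci ei] := xlo hs; rewrite leqNgt; apply/negP => hlt.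
  have := ncross u (i, u.2) uU; rewrite inE [clean_col _ _]ci /= andbT.
  rewrite inE /= => H; have /H : (ndist c.1 i <= L) && (ndist c.2 u.2 <= L).
    by move: hu xlh ylh xc ei; clear; rewrite /ndist; lia.
  move/negP; apply; apply: nr_mono hab => /=; move: hu ei hlt; clear;
    by rewrite /ndist; lia.
have mvy s (u : cell) a b : u \in G -> nr a b ->
    (if s then c.2 + L < m else L <= c.2) ->
    if s then u.2 + b < yh else yl + b <= u.2.
  move=> /GP[uU hu] hab hs.
  case: s hs => hs.
    have [i ci ei] := yhi hs; rewrite ltnNge; apply/negP => hle.
    have := ncross u (u.1, i) uU; rewrite inE [clean_row _ _]ci /= orbT andbT.
    rewrite inE /= => H; have /H : (ndist c.1 u.1 <= L) && (ndist c.2 i <= L).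
      by move: hu xlh ylh yc ei; clear; rewrite /ndist; lia.
    move/negP; apply; apply: nr_mono hab => /=; move: hu ei hle; clear;
      by rewrite /ndist; lia.
  have [i ci ei] := ylo hs; rewrite leqNgt; apply/negP => hlt.
  have := ncross u (u.1, i) uU; rewrite inE [clean_row _ _]ci /= orbT andbT.
  rewrite inE /= => H; have /H : (ndist c.1 u.1 <= L) && (ndist c.2 i <= L).
    by move: hu xlh ylh yc ei; clear; rewrite /ndist; lia.
  move/negP; apply; apply: nr_mono hab => /=; move: hu ei hlt; clear;
    by rewrite /ndist; lia.
(* Beyond an element of G that is extreme in the first coordinate, all cells
   adjacent to it are sparse. *)
have half (s : bool) : exists2 u, u \in G &
    forall v, v \in G -> ~~ beyond s u.1 v.1.
  case: s.
    case: (@arg_maxnP _ c (mem G) (fun u => u.1) cG) => u uG H; exists u => // v vG.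
    by rewrite /beyond -leqNgt; apply: H.
  case: (@arg_minnP _ c (mem G) (fun u => u.1) cG) => u uG H; exists u => // v vG.
  by rewrite /beyond -leqNgt; apply: H.
have quad (s t : bool) (u : cell) : u \in G ->
    (forall v, v \in G -> ~~ beyond s u.1 v.1) ->
    (if s then c.1 + L < m else L <= c.1) ->
    (if t then c.2 + L < m else L <= c.2) ->
    q <= #|[set v in box L c :\: D | beyond s u.1 v.1 && beyond t u.2 v.2]|.
  move=> uG ext os ot; apply: quadrant_card => [a b hab|v huv b1 b2].
    split.
      by move: xm (mvx s u _ _ uG hab os); clear; case: s; lia.
    by move: ym (mvy t u _ _ uG hab ot); clear; case: t; lia.
  (* [mvx] and [mvy] keep [v] inside the gap. Were [v] dense, closure would put it into [U], hence
     into [G], against the extremality of [u]. *)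
  have vgap : (xl <= v.1 < xh) && (yl <= v.2 < yh).
    have [_ /andP[hx hy]] := GP _ uG; apply/andP; split.
      move: hx b1 (mvx s u _ _ uG huv os); clear; rewrite /beyond /ndist.
      by case: s; lia.
    move: hy b2 (mvy t u _ _ uG huv ot); clear; rewrite /beyond /ndist.
    by case: t; lia.
  have uU : u \in U by move: uG; rewrite inE => /andP[].
  rewrite inE Gbox // andbT; apply: contraL b1 => vD; apply: ext.
  by rewrite inE vgap andbT; apply: (closed u).
have hrow (s : bool) (u : cell) : u \in G ->
    (forall v, v \in G -> ~~ beyond s u.1 v.1) ->
    (if s then c.1 + L < m else L <= c.1) ->
    q * nopen m L c.2 <= #|[set v in box L c :\: D | beyond s u.1 v.1]|.
  move=> uG ext os.
  (* The quadrants below and above the height of [u] are disjoint, and [nopen] counts those that are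
     not cut off. *)
  rewrite -(cardsID [set v : cell | v.2 < u.2]) /nopen mulnDr leq_add //.
    case: (leqP L c.2) => ho; last by rewrite muln0.
    rewrite muln1; apply: leq_trans (quad s false u uG ext os ho) _.
    by apply: subset_leq_card; apply/fintype.subsetP => v; rewrite !inE !andbA.
  case: (ltnP (c.2 + L) m) => ho; last by rewrite muln0.
  rewrite muln1; apply: leq_trans (quad s true u uG ext os ho) _.
  apply: subset_leq_card; apply/fintype.subsetP => v; rewrite !inE.
  by case/and3P=> -> -> h; rewrite -leqNgt ltnW.
have [u uG hu] := half true; have [u' uG' hu'] := half false.
have uu' : u'.1 <= u.1.
  by have := hu' _ uG; rewrite /beyond -leqNgt.
have := few c; rewrite ltnNge => /negP; apply.
(* The cells to the left of [u'] and those to the right of [u] are disjoint, by [uu']; together they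
   are as many as [few] forbids. *)
rewrite -(cardsID [set v : cell | v.1 < u'.1]) /nopen -mulnA [X in q * X]mulnC mulnA.
rewrite mulnDr leq_add //.
  case: (leqP L c.1) => ho; last by rewrite muln0.
  rewrite muln1; apply: leq_trans (hrow false u' uG' hu' ho) _.
  by apply: subset_leq_card; apply/fintype.subsetP => v; rewrite !inE.
case: (ltnP (c.1 + L) m) => ho; last by rewrite muln0.
rewrite muln1; apply: leq_trans (hrow true u uG hu ho) _.
apply: subset_leq_card; apply/fintype.subsetP => v; rewrite !inE.
by case/andP=> -> h; rewrite -leqNgt (leq_trans uu') // ltnW.
Qed.

Notation linked := (connect dense_adj).

Lemma cell_adj_refl u : cell_adj nr u u.
Proof. by apply: nr_mono nr10; rewrite /ndist subnn. Qed.

Lemma cell_adj_sym : symmetric (cell_adj nr).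
Proof. by move=> u v; rewrite /cell_adj /ndist addnC [X in nr _ X]addnC. Qed.

Lemma linked_sym u v : linked u v = linked v u.
Proof.
apply: sym_connect_sym => x y; rewrite /dense_adj cell_adj_sym.
by case: (x \in D); case: (y \in D).
Qed.

Lemma dense_reaches_cross c : c \in D -> exists2 g, g \in cross c & linked c g.
Proof.
move=> cD.
case: (boolP [exists g, (g \in cross c) && linked c g]) => [/existsP[g /andP[]]|H].
  by exists g.
exfalso; apply: (@cross_unavoidable c [set u | linked c u && (u \in D)]).
- by rewrite inE connect0.
- move=> u v; rewrite !inE => /andP[cu uD] uv vD; rewrite vD andbT.
  by apply: connect_trans cu (connect1 _); rewrite /dense_adj uD vD.
- move=> u g; rewrite inE => /andP[cu uD] gc; apply: contraNN H => ug.
  apply/existsP; exists g; rewrite gc; apply: connect_trans cu (connect1 _).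
  by rewrite /dense_adj uD ug (cross_dense gc).
Qed.

Lemma dense_neighbour c : exists2 d, d \in D & cell_adj nr c d.
Proof.
case: (boolP (c \in D)) => cD; first by exists c => //; apply: cell_adj_refl.
case: (boolP [exists d, (d \in D) && cell_adj nr c d]) => [/existsP[d /andP[]]|H].
  by exists d.
exfalso; apply: (@cross_unavoidable c [set c]); first by rewrite inE.
- move=> u v /set1P -> cv vD; case/negP: H; apply/existsP; exists v.
  by rewrite vD.
- move=> u g /set1P -> gc; apply: contraNN H => cg; apply/existsP; exists g.
  by rewrite (cross_dense gc).
Qed.

Lemma clean_col_linked (c : cell) (i j j' : 'I_m) : clean_col c i ->
  (i, j) \in box L c -> (i, j') \in box L c -> linked (i, j) (i, j').
Proof.
move=> /forallP ci.
wlog jj' : j j' / j <= j' => [W|].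
  case: (leqP j j') => h bj bj'; first exact: W.
  by rewrite linked_sym; apply: W => //; apply: ltnW.
move=> bj; have [k] := ubnP (j' - j); elim: k => // k IH in j' jj' *.
move=> hk bj'; case: (eqVneq j j') => [->|ne]; first exact: connect0.
have lt : j < j' by rewrite ltn_neqAle ne.
have hp : j'.-1 < m by have := ltn_ord j'; lia.
have bp : (i, Ordinal hp) \in box L c.
  by move: bj bj'; rewrite !inE /= /ndist; move: lt; clear; lia.
apply: connect_trans (IH (Ordinal hp) _ _ bp) (connect1 _).
- by rewrite /=; lia.
- by rewrite /=; lia.
have := ci (i, Ordinal hp); have := ci (i, j').
rewrite bp bj' eqxx /= => h1 h2; rewrite /dense_adj h1 h2 /=.
by apply: nr_mono nr01; rewrite /= /ndist; move: lt; clear; lia.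
Qed.

Lemma clean_row_linked (c : cell) (j i i' : 'I_m) : clean_row c j ->
  (i, j) \in box L c -> (i', j) \in box L c -> linked (i, j) (i', j).
Proof.
move=> /forallP cj.
wlog ii' : i i' / i <= i' => [W|].
  case: (leqP i i') => h bi bi'; first exact: W.
  by rewrite linked_sym; apply: W => //; apply: ltnW.
move=> bi; have [k] := ubnP (i' - i); elim: k => // k IH in i' ii' *.
move=> hk bi'; case: (eqVneq i i') => [->|ne]; first exact: connect0.
have lt : i < i' by rewrite ltn_neqAle ne.
have hp : i'.-1 < m by have := ltn_ord i'; lia.
have bp : (Ordinal hp, j) \in box L c.
  by move: bi bi'; rewrite !inE /= /ndist; move: lt; clear; lia.
apply: connect_trans (IH (Ordinal hp) _ _ bp) (connect1 _).
- by rewrite /=; lia.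
- by rewrite /=; lia.
have := cj (Ordinal hp, j); have := cj (i', j).
rewrite bp bi' eqxx /= => h1 h2; rewrite /dense_adj h1 h2 /=.
by apply: nr_mono nr10; rewrite /= /ndist; move: lt; clear; lia.
Qed.

(** Since 2L < m, at least one side of [x] has room for L + 1 lines including that of [x]; one side
    is enough to find clean lines. *)
Lemma window (x : 'I_m) : exists lo hi,
  [/\ hi <= m, L < hi - lo & forall k, lo <= k < hi -> ndist x k <= L].
Proof.
have := ltn_ord x; rewrite /ndist; case: (leqP L x) => hx hxm.
  by exists (x - L), x.+1; split=> *; lia.
by exists x, (x + L).+1; split=> *; lia.
Qed.

Lemma in_box (c : cell) i j : ((i, j) \in box L c) = (ndist c.1 i <= L) && (ndist c.2 j <= L).
Proof. by rewrite inE. Qed.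

Lemma cross_linked (c g g' : cell) : g \in cross c -> g' \in cross c -> linked g g'.
Proof.
have [xl [xh [hx1 hx2 hx3]]] := window c.1; have [yl [yh [hy1 hy2 hy3]]] := window c.2.
have [||i ib ci] := @col_window c xl xh => //; first lia.
have [||j jb cj] := @row_window c yl yh => //; first lia.
(* Every clean line of the window meets the perpendicular one of the clean lines [i] and [j], so all
   are linked to their intersection. *)
have hub h : h \in cross c -> linked h (i, j).
  case: h => h1 h2; rewrite inE in_box => /andP[/andP[/= b1 b2] /orP[] ch].
    apply: (@connect_trans _ _ (h1, j)).
      by apply: (clean_col_linked ch); rewrite in_box /= ?b1 ?b2 ?hy3.
    by apply: (clean_row_linked cj); rewrite in_box /= ?b1 ?b2 ?hx3 ?hy3.
  apply: (@connect_trans _ _ (i, h2)).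
    by apply: (clean_row_linked ch); rewrite in_box /= ?b1 ?b2 ?hx3.
  by apply: (clean_col_linked ci); rewrite in_box /= ?b1 ?b2 ?hx3 ?hy3.
by move=> /hub hg /hub hg'; apply: connect_trans hg _; rewrite linked_sym.
Qed.

(** The two windows have the same range of rows and together less than [8 * q] sparse cells, so some
    row is clean in both. *)
Lemma cross_step_x (c c' : cell) : c'.1 = c.1.+1 :> nat -> c'.2 = c.2 ->
  exists2 g, g \in cross c & g \in cross c'.
Proof.
move=> e1 e2; have [yl [yh [hy1 hy2 hy3]]] := window c.2.
have hS : #|(box L c :\: D) :|: (box L c' :\: D)| < yh - yl.
  have := few4 c; have := few4 c'; move: hL hy2.
  by rewrite cardsU; clear; lia.
have [j jb H] := exists_unhit (fun v : cell => v.2) hy1 hS.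
exists (c.1, j); rewrite inE in_box /=.
  rewrite hy3 // /ndist subnn /=; apply/orP; right; apply/clean_rowP => v vb.
  by apply: H; rewrite inE vb.
rewrite e2 hy3 // e1 /ndist andbT; apply/andP; split.
  by move: hL; clear; lia.
by apply/orP; right; apply/clean_rowP => v vb; apply: H; rewrite inE vb orbT.
Qed.

Lemma cross_step_y (c c' : cell) : c'.2 = c.2.+1 :> nat -> c'.1 = c.1 ->
  exists2 g, g \in cross c & g \in cross c'.
Proof.
move=> e1 e2; have [xl [xh [hx1 hx2 hx3]]] := window c.1.
have hS : #|(box L c :\: D) :|: (box L c' :\: D)| < xh - xl.
  have := few4 c; have := few4 c'; move: hL hx2.
  by rewrite cardsU; clear; lia.
have [i ib H] := exists_unhit (fun v : cell => v.1) hx1 hS.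
exists (i, c.2); rewrite inE in_box /=.
  rewrite hx3 // /ndist subnn /=; apply/orP; left; apply/clean_colP => v vb.
  by apply: H; rewrite inE vb.
rewrite e2 hx3 // e1 /ndist /=; apply/andP; split.
  by move: hL; clear; lia.
by apply/orP; left; apply/clean_colP => v vb; apply: H; rewrite inE vb orbT.
Qed.

Lemma cross_all_linked (c c' g g' : cell) :
  g \in cross c -> g' \in cross c' -> linked g g'.
Proof.
have m0 : 0 < m by lia.
pose o := Ordinal m0.
have row i : forall (hi : i < m) h h',
    h \in cross (o, o) -> h' \in cross (Ordinal hi, o) -> linked h h'.
  elim: i => [|i IH] hi h h' hc hc'.
    apply: (cross_linked hc); suff -> : o = Ordinal hi by []; exact: val_inj.
  have [k k1 k2] := @cross_step_x (Ordinal (ltnW hi), o) (Ordinal hi, o) erefl erefl.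
  exact: connect_trans (IH _ _ _ hc k1) (cross_linked k2 hc').
have all i j : forall (hi : i < m) (hj : j < m) h h',
    h \in cross (o, o) -> h' \in cross (Ordinal hi, Ordinal hj) -> linked h h'.
  elim: j => [|j IH] hi hj h h' hc hc'.
    apply: (row i hi _ _ hc); suff -> : o = Ordinal hj by []; exact: val_inj.
  have [k k1 k2] := @cross_step_y (Ordinal hi, Ordinal (ltnW hj)) (Ordinal hi, Ordinal hj) erefl erefl.
  exact: connect_trans (IH _ _ _ _ hc k1) (cross_linked k2 hc').
have [k kc _] : exists2 k, k \in cross (o, o) & true.
  have [xl [xh [hx1 hx2 hx3]]] := window o.
  have [||i ib ci] := @col_window (o, o) xl xh => //; first lia.
  by exists (i, o) => //; rewrite inE in_box ci /= hx3.
case: c c' => [[i hi] [j hj]] [[i' hi'] [j' hj']] hg hg'.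
apply: (@connect_trans _ _ k); last exact: all kc hg'.
by rewrite linked_sym; apply: all kc hg.
Qed.

Lemma dense_linked u v : u \in D -> v \in D -> linked u v.
Proof.
move=> /dense_reaches_cross[g gc ug] /dense_reaches_cross[h hc vh].
apply: connect_trans ug _; apply: (connect_trans (cross_all_linked gc hc)).
by rewrite linked_sym.
Qed.

End GridConnectivity.

(** * Hamiltonian cycles in blow-ups *)

Section CyclicPairs.
Variables (V C : eqType) (cl : V -> C).

Definition both_in (d : C) : rel V := fun u v => (cl u == d) && (cl v == d).

Definition line_pairs (d : C) (x : V) (s : seq V) : nat :=
  count id (pairmap (both_in d) x s).

(** Starting from [last x p] also counts the pair that closes the cycle. *)
Definition cyclic_pairs (d : C) (s : seq V) : nat :=
  if s is x :: p then line_pairs d (last x p) s else 0.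

Lemma line_pairs_cat d x s t :
  line_pairs d x (s ++ t) = line_pairs d x s + line_pairs d (last x s) t.
Proof. by rewrite /line_pairs pairmap_cat count_cat. Qed.

Lemma cyclic_pairs_rot d n s : cyclic_pairs d (rot n s) = cyclic_pairs d s.
Proof.
rewrite /rot -{3}(cat_take_drop n s).
have H x a t : cyclic_pairs d ((x :: a) ++ t) =
    line_pairs d (last (last x a) t) ((x :: a) ++ t).
  by rewrite /cyclic_pairs /= last_cat.
case: (take n s) (drop n s) => [|x a] [|y b]; rewrite ?cats0 //.
by rewrite !H !line_pairs_cat addnC.
Qed.

Lemma line_pairsP d x s : 0 < line_pairs d x s ->
  exists s1 y s2, [/\ s = s1 ++ y :: s2, cl (last x s1) = d & cl y = d].
Proof.
elim: s x => //= z s IH x; rewrite /line_pairs /=.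
case: (boolP (both_in d x z)) => [/andP[/eqP xd /eqP zd] _|_ /=].
  by exists [::], z, s.
by move=> /IH[s1 [y [s2 [-> h1 h2]]]]; exists (z :: s1), y, s2.
Qed.

(** A rotation makes the given pair the closing one, so that inserting between its members becomes
    appending. *)
Lemma cyclic_pairs_gt0 d s : 0 < cyclic_pairs d s ->
  exists n y p, [/\ rot n s = y :: p, cl y = d & cl (last y p) = d].
Proof.
case: s => // x p /line_pairsP[s1 [y [s2 [E h1 h2]]]].
exists (size s1), y, (s2 ++ s1); rewrite E rot_size_cat /=; split => //.
by rewrite last_cat; case: s1 h1 E => [|z s1] //= + [<- <-].
Qed.

Lemma line_pairs_all d x s : cl x = d -> (forall y, y \in s -> cl y = d) ->
  line_pairs d x s = size s.
Proof.
elim: s x => //= y s IH x xd H; rewrite /line_pairs /= /both_in xd H ?mem_head //.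
rewrite eqxx /= -/(line_pairs d y s) IH ?H ?mem_head // => z zs.
by apply: H; rewrite inE zs orbT.
Qed.

End CyclicPairs.

(** * Inserting the cells one at a time into a cycle *)

Section Blowup.
Variables (V C : finType) (cl : V -> C) (e : rel V) (adj : rel C) (M : nat).
Variable (D : {set C}).
Hypothesis He : forall u v, u != v -> adj (cl u) (cl v) -> e u v.
Hypothesis adj_refl : reflexive adj.
Hypothesis adj_sym : symmetric adj.
Hypothesis adj_deg : forall c, #|[set d | adj c d]| <= M.
Hypothesis M2 : 2 < M.
Hypothesis D_big : forall d, d \in D -> M <= #|[set v | cl v == d]|.
Hypothesis D_linked : forall u v, u \in D -> v \in D ->
  connect (fun u v => [&& u \in D, v \in D & adj u v]) u v.
Hypothesis D_near : forall c, exists2 d, d \in D & adj c d.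

Definition pts (c : C) : seq V := enum [set v | cl v == c].

Lemma mem_pts c v : (v \in pts c) = (cl v == c).
Proof. by rewrite mem_enum inE. Qed.

Lemma clique_path x s : uniq (x :: s) ->
  {in x :: s &, forall u v, adj (cl u) (cl v)} -> path e x s.
Proof.
elim: s x => //= y s IH x /andP[xys /andP[ys us]] H.
rewrite He /=; first by apply: IH; [rewrite /= ys|move=> u v hu hv; apply: H; rewrite inE ?hu ?hv orbT].
  by apply: contraNneq xys => ->; rewrite mem_head.
by apply: H; rewrite ?mem_head // !inE eqxx orbT.
Qed.

(** [F] is the set of cells already inserted. A dense cell loses at most one consecutive pair for
    each neighbour inserted, so its pairs and its inserted neighbours together never drop below [M].
    As it has at most [M] neighbours, a pair remains as long as some neighbour is missing. *)
Definition partial_cycle (F : {set C}) (s : seq V) :=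
  [/\ ucycle e s, forall v, (v \in s) = (cl v \in F), 2 < size s &
      forall d, d \in D -> d \in F -> M <= cyclic_pairs cl d s + #|[set f in F | adj d f]|].

Lemma partial_cycle_start d : d \in D -> partial_cycle [set d] (pts d).
Proof.
move=> dD; have sz : M <= size (pts d) by rewrite -cardE; apply: D_big.
have H : {in pts d &, forall u v, adj (cl u) (cl v)}.
  by move=> u v; rewrite !mem_pts => /eqP -> /eqP ->.
have U : uniq (pts d) by apply: enum_uniq.
split.
- rewrite /ucycle U andbT; case E : (pts d) => [|x p] //=.
  rewrite rcons_path; apply/andP; split.
    by apply: clique_path; rewrite -E.
  move: sz; rewrite E; case: p E => [|y p] E; first by rewrite /=; lia.
  move=> _; apply: He.
    by move: U; rewrite E; case/andP=> + _; apply: contraNneq => <-; rewrite /= mem_last.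
  by apply: H; rewrite E ?mem_head // mem_last.
- by move=> v; rewrite mem_pts inE.
- exact: leq_trans sz.
move=> d' _ /set1P ->; apply: leq_trans (leq_addr _ _); apply: (leq_trans sz).
rewrite /cyclic_pairs; case E : (pts d) => [|x p] //.
rewrite line_pairs_all //; last by move=> y; rewrite -E mem_pts => /eqP.
by apply/eqP; rewrite -mem_pts E mem_last.
Qed.

Lemma partial_cycle_insert F s f d : partial_cycle F s ->
  f \notin F -> d \in F -> d \in D -> adj d f -> exists s', partial_cycle (f |: F) s'.
Proof.
move=> [cs ms ss inv] fF dF dD df.
(* [f] is a neighbour of [d] outside [F], so the invariant leaves a pair of [d] to be opened. *)
have cF1 : #|[set g in F | adj d g]| < M.
  apply: leq_trans (adj_deg d); apply: proper_card; apply/properP; split.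
    by apply/fintype.subsetP => g; rewrite !inE => /andP[].
  by exists f; rewrite !inE ?df // (negbTE fF).
have /cyclic_pairs_gt0[n [y [p [E yd zd]]]] : 0 < cyclic_pairs cl d s.
  by have := inv d dD dF; lia.
have us' : uniq (y :: p) by rewrite -E rot_uniq; case/andP: cs.
have cs' : cycle e (y :: p) by rewrite -E rot_cycle; case/andP: cs.
have ms' v : (v \in y :: p) = (cl v \in F) by rewrite -E mem_rot.
have fp v : v \in pts f -> v \notin y :: p.
  by rewrite mem_pts ms' => /eqP ->.
have adjf v w : v \in pts f -> cl w = d -> e w v && e v w.
  move=> vf wd; have wF : w \in y :: p by rewrite ms' wd.
  have ne : w != v by apply: contraNneq (fp _ vf) => <-.
  move: vf; rewrite mem_pts => /eqP vf.
  by rewrite !He ?wd ?vf ?ne 1?eq_sym ?ne // adj_sym. 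
(* The points of [f], possibly none, go between [last y p] and [y], which both lie in [d]. *)
exists (y :: p ++ pts f); split.
- rewrite /ucycle -cat_cons cat_uniq us' enum_uniq andbT /=; apply/andP; split; last first.
    by rewrite -all_predC; apply/allP => v /fp.
  move: cs'; rewrite /= rcons_cat cat_path rcons_path => /andP[-> ezy] /=.
  case Ef : (pts f) => [|a b]; first by rewrite /= ezy.
  rewrite /= rcons_path; apply/and3P; split.
  + by case/andP: (@adjf a (last y p) ltac:(by rewrite Ef mem_head) zd).
  + apply: clique_path; rewrite -Ef ?enum_uniq // => u v.
    by rewrite !mem_pts => /eqP -> /eqP ->.
  by case/andP: (@adjf (last a b) y ltac:(by rewrite Ef mem_last) yd).
- by move=> v; rewrite -cat_cons mem_cat ms' mem_pts in_setU1 orbC.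
- by rewrite -cat_cons size_cat -E size_rot; apply: leq_trans ss (leq_addr _ _).
move=> d' d'D; rewrite in_setU1; case: (eqVneq d' f) => [d'f _|d'f /= d'F].
  (* A newly inserted dense cell has one consecutive pair less than points; it makes up for this by
     counting as its own neighbour. *)
  subst d'; have : 0 < #|[set g in f |: F | adj f g]|.
    by apply/card_gt0P; exists f; rewrite !inE eqxx adj_refl.
  set K := #|_|; have : M <= size (pts f) by rewrite -cardE; apply: D_big.
  rewrite /cyclic_pairs -cat_cons line_pairs_cat.
  have H v : v \in pts f -> cl v = f by rewrite mem_pts => /eqP.
  case Ef : (pts f) => [|a b]; first by rewrite /=; lia.
  rewrite /= /line_pairs /= -/(line_pairs cl f a b) (@line_pairs_all _ _ cl f a b) //.
  + move=> h1 h2; apply: (leq_trans h1); rewrite -addn1 leq_add //.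
    by rewrite addnA leq_addl.
  + by apply: H; rewrite Ef mem_head.
  by move=> v vb; apply: H; rewrite Ef inE vb orbT.
(* Only the closing pair is broken, and it counted for [d] alone. *)
have key : cyclic_pairs cl d' s <= cyclic_pairs cl d' (y :: p ++ pts f) + (d' == d).
  rewrite -(cyclic_pairs_rot _ _ n) E /cyclic_pairs -cat_cons line_pairs_cat /line_pairs /=.
  rewrite {1}/both_in yd zd andbb eq_sym.
  case: (eqVneq d d') => _ /=; first by clear; lia.
  by case: (pts f) => [|a b] /=; clear; lia.
have sub : [set g in F | adj d' g] \subset [set g in f |: F | adj d' g].
  by apply/fintype.subsetP => g; rewrite !inE => /andP[-> ->]; rewrite orbT.
have := inv d' d'D d'F; case: (eqVneq d' d) key => [->|_] key.
  have : #|[set g in F | adj d g]| < #|[set g in f |: F | adj d g]|.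
    apply: proper_card; apply/properP; split.
      by apply/fintype.subsetP => g; rewrite !inE => /andP[-> ->]; rewrite orbT.
    by exists f; rewrite !inE ?eqxx ?df ?(negbTE fF).
  by move=> h1 h2; move: key h1 h2; rewrite /=; clear; lia.
by have := subset_leq_card sub; move: key; clear; rewrite /=; lia.
Qed.

(** If [F] contains all dense cells, any missing cell has a dense neighbour in [F]. Otherwise a path
    of dense cells from [d0] to a dense cell outside [F] leaves [F] at some step. *)
Lemma exists_insertable (F : {set C}) d0 : d0 \in D -> d0 \in F -> F != [set: C] ->
  exists f d, [/\ f \notin F, d \in F, d \in D & adj d f].
Proof.
move=> d0D d0F FT.
case: (boolP (D \subset F)) => [/fintype.subsetP DF|/subsetPn[x xD xF]].
  have [f _ fF] : exists2 f, true & f \notin F.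
    case: (boolP [exists f, f \notin F]) => [/existsP[f hf]|H]; first by exists f.
    case/eqP: FT; apply/setP => f; rewrite inE; apply: contraNT H => hf.
    by apply/existsP; exists f.
  have [d dD fd] := D_near f; exists f, d; split => //; first exact: DF.
  by rewrite adj_sym.
have /connectP[p pp lp] := D_linked d0D xD.
elim: p d0 d0D d0F pp lp => [|y p IH] d0 d0D d0F /=.
  by move=> _ xd; rewrite xd d0F in xF.
case/andP=> /and3P[_ yD dy] pp lp; case: (boolP (y \in F)) => yF; first exact: IH lp.
by exists y, d0.
Qed.

Lemma partial_cycle_full d0 : d0 \in D -> exists s, partial_cycle [set: C] s.
Proof.
move=> d0D.
suff H k : forall F s, #|~: F| <= k -> d0 \in F -> partial_cycle F s ->
    exists s, partial_cycle [set: C] s.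
  by apply: (H _ [set d0] _ (leqnn _)); [rewrite inE|apply: partial_cycle_start].
elim: k => [|k IH] F s hk dF hs.
  move: hk; rewrite leqn0 cards_eq0 => /eqP F0; exists s.
  by rewrite -[F]setCK F0 setC0 in hs.
case: (eqVneq F [set: C]) => [E|FT]; first by exists s; rewrite -E.
have [f [d [fF dF' dD df]]] := exists_insertable d0D dF FT.
have [s' hs'] := partial_cycle_insert hs fF dF' dD df.
apply: (IH (f |: F) s') => //; last by rewrite in_setU1 dF orbT.
rewrite -ltnS; apply: leq_trans hk; apply: proper_card; apply/properP; split.
  by apply/fintype.subsetP => g; rewrite !inE negb_or => /andP[].
by exists f; rewrite !inE ?eqxx.
Qed.

Lemma blowup_hamiltonian : D != set0 ->
  exists c : seq V, [/\ (2 < size c)%N, ucycle e c & forall v, v \in c].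
Proof.
case/set0Pn => d0 /partial_cycle_full[s [h1 h2 h3 _]]; exists s; split => // v.
by rewrite h2 inE.
Qed.

End Blowup.

Import Order.TTheory GRing.Theory Num.Theory.
Local Open Scope ring_scope.

(** * Counting configurations of points in cells *)

(** Independence of the points, in the form of counting. *)
Lemma card_ffun_family (n : nat) (C : finType) (G : 'I_n -> {set C}) :
  #|[set y : {ffun 'I_n -> C} | [forall t, y t \in G t]]| = (\prod_t #|G t|)%N.
Proof.
have -> : #|[set y : {ffun 'I_n -> C} | [forall t, y t \in G t]]| = #|family (fun t => mem (G t))|.
  apply: eq_card => y; rewrite inE; apply/forallP/familyP => H t; exact: (H t).
by rewrite card_family foldrE big_map big_enum.
Qed.

Lemma card_indicator (R : numDomainType) (T : finType) (A : {set T}) :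
  #|A|%:R = \sum_y (y \in A)%:R :> R.
Proof. by rewrite -sum1_card natr_sum big_mkcond; apply: eq_bigr => y _; case: (y \in A). Qed.

(** * The second moment method on a finite uniform space *)

Section SecondMoment.
Context {R : realFieldType}.
Variables (Y I : finType) (A : I -> {set Y}) (kappa : R).
Let a i : R := #|A i|%:R / #|Y|%:R.
Let mu : R := \sum_i a i.

(** Chebyshev's inequality for the number N of events that occur: the hypothesis bounds E[N^2] by mu
    + kappa mu^2, so the variance divided by mu^2 is at most 1 / mu + kappa - 1. *)
Lemma second_moment : (0 < #|Y|)%N -> 0 < mu ->
  (forall i j, #|A i :&: A j|%:R / #|Y|%:R <= (i == j)%:R * a i + kappa * (a i * a j)) ->
  #|[set y | [forall i, y \notin A i]]|%:R / #|Y|%:R <= mu^-1 + kappa - 1.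
Proof.
move=> Y0 mu0 H; have Y0' : 0 < #|Y|%:R :> R by rewrite ltr0n.
pose N (y : Y) : R := \sum_i (y \in A i)%:R.
have S1 : \sum_y N y = #|Y|%:R * mu.
  rewrite exchange_big /= /mu mulr_sumr; apply: eq_bigr => i _.
  by rewrite /a mulrCA divff ?mulr1 ?card_indicator // gt_eqF.
have S2 : \sum_y N y ^+ 2 <= #|Y|%:R * (mu + kappa * mu ^+ 2).
  have -> : \sum_y N y ^+ 2 = \sum_i \sum_j #|A i :&: A j|%:R.
    rewrite (eq_bigr (fun y => \sum_i \sum_j (y \in A i :&: A j)%:R)); last first.
      move=> y _; rewrite expr2 /N mulr_suml; apply: eq_bigr => i _.
      rewrite mulr_sumr; apply: eq_bigr => j _.
      by rewrite inE -natrM mulnb.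
    rewrite exchange_big; apply: eq_bigr => i _; rewrite exchange_big.
    by apply: eq_bigr => j _; rewrite card_indicator.
  have -> : mu + kappa * mu ^+ 2 = \sum_i \sum_j ((i == j)%:R * a i + kappa * (a i * a j)).
    rewrite [RHS](eq_bigr (fun i => a i + kappa * (a i * mu))) => [|i _].
      by rewrite big_split /= -mulr_sumr -mulr_suml -expr2.
    rewrite big_split /= -!mulr_sumr; congr (_ + _).
    rewrite (bigD1 i) //= eqxx mul1r big1 ?addr0 // => j.
    by rewrite eq_sym => /negbTE ->; rewrite mul0r.
  rewrite mulr_sumr; apply: ler_sum => i _; rewrite mulr_sumr; apply: ler_sum => j _.
  by rewrite mulrC -ler_pdivrMr.
set Z := [set y | _]; rewrite ler_pdivrMr //.
have : #|Z|%:R * mu ^+ 2 <= \sum_y (N y - mu) ^+ 2.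
  rewrite card_indicator mulr_suml; apply: ler_sum => y _.
  case: (boolP (y \in Z)); last by rewrite mul0r sqr_ge0.
  rewrite inE => /forallP hy; rewrite /N big1 ?sub0r ?sqrrN ?mul1r // => i _.
  by rewrite (negbTE (hy i)).
have -> : \sum_y (N y - mu) ^+ 2 = \sum_y N y ^+ 2 - #|Y|%:R * mu ^+ 2.
  rewrite (eq_bigr (fun y => N y ^+ 2 + ((- 2 * mu) * N y + mu ^+ 2))); last by move=> y _; ring.
  by rewrite !big_split /= -mulr_sumr S1 sumr_const -mulr_natl; ring.
move=> h; have m2 : 0 < mu ^+ 2 by rewrite exprn_gt0.
rewrite -(ler_pM2r m2); apply: (le_trans h).
apply: (@le_trans _ _ (#|Y|%:R * (mu + kappa * mu ^+ 2) - #|Y|%:R * mu ^+ 2)).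
  by rewrite lerD2r.
rewrite [leRHS](_ : _ = #|Y|%:R * (mu * (mu * mu^-1) + kappa * mu ^+ 2) - #|Y|%:R * mu ^+ 2); last by ring.
by rewrite divff ?mulr1 // gt_eqF.
Qed.

End SecondMoment.

(** * Existence of an isolated point *)

Section IsolatedPoint.
Context {R : realFieldType}.
Variables (n b : nat) (C : finType) (K : {set C}) (bg : C -> {set C}).
Hypothesis n2 : (1 < n)%N.
Hypothesis bgK : forall k, k \in K -> k \in bg k.
Hypothesis bgb : forall k, k \in K -> (#|bg k| <= b)%N.
Hypothesis bC : (b < #|C|)%N.
Hypothesis K0 : (0 < #|K|)%N.
Hypothesis bg_disj : forall k l, k \in K -> l \in K -> k != l -> [disjoint bg k & bg l].

(** [bg k] will be the set of cells that touch [k], so that a lonely point has no neighbour in the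
    graph. *)
Definition lonely (k : C) (i : 'I_n) (y : {ffun 'I_n -> C}) : bool :=
  [&& k \in K, y i == k & [forall j, (j != i) ==> (y j \notin bg k)]].

Let G (ki : C * 'I_n) (t : 'I_n) : {set C} :=
  if t == ki.2 then [set ki.1] else ~: bg ki.1.
Let A (ki : C * 'I_n) : {set {ffun 'I_n -> C}} :=
  [set y | lonely ki.1 ki.2 y].

Let AE ki : ki.1 \in K -> A ki = [set y : {ffun 'I_n -> C} | [forall t, y t \in G ki t]].
Proof.
case: ki => k i /= kK; apply/setP => y; rewrite !inE /lonely /= kK /G /=.
apply/andP/forallP => [[/eqP yi /forallP H] t|H].
  by case: eqVneq => [->|ti]; [rewrite yi inE|have := H t; rewrite ti inE].
split; first by have := H i; rewrite eqxx inE.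
by apply/forallP => j; apply/implyP => ji; have := H j; rewrite (negbTE ji) inE.
Qed.

Let A0 ki : ki.1 \notin K -> A ki = set0.
Proof. by move=> kK; apply/setP => y; rewrite !inE /lonely (negbTE kK). Qed.

Let cardA ki : ki.1 \in K -> #|A ki| = ((#|C| - #|bg ki.1|) ^ n.-1)%N.
Proof.
move=> kK; rewrite AE // card_ffun_family (bigD1 ki.2) //= /G eqxx cards1 mul1n.
rewrite (eq_bigr (fun=> #|C| - #|bg ki.1|)%N); last first.
  by move=> t /negbTE ->; rewrite cardsCs finset.setCK.
by rewrite prod_nat_const cardC1 card_ord.
Qed.

(** The two events exclude each other when they share the point or the cell. Otherwise each of the n
    - 2 remaining points avoids two disjoint sets, of sizes x and y, and (c - x - y) c <= (c - x)(c
    - y). *)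
Let cardAA ki lj : ki.1 \in K -> lj.1 \in K -> ki != lj ->
  (#|A ki :&: A lj| * (#|C| ^ (n - 2)) <= (#|C| - #|bg ki.1|) ^ (n - 2) * (#|C| - #|bg lj.1|) ^ (n - 2))%N.
Proof.
case: ki lj => k i [l j] /= kK lK ne; rewrite !AE //.
have [ij|ij] := eqVneq i j.
  subst j; have kl : k != l by apply: contra_neq ne => ->.
  rewrite (_ : _ :&: _ = set0) ?cards0 ?mul0n //; apply/setP => y; rewrite !inE.
  apply/negP => /andP[/forallP/(_ i) h1 /forallP/(_ i)]; move: h1; rewrite /G /= eqxx !inE => /eqP ->.
  by rewrite (negbTE kl).
have [kl|kl] := eqVneq k l.
  subst l; rewrite (_ : _ :&: _ = set0) ?cards0 ?mul0n //; apply/setP => y; rewrite !inE.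
  apply/negP => /andP[/forallP/(_ i) h1 /forallP/(_ i)]; move: h1.
  by rewrite /G /= eqxx (negbTE ij) !inE => /eqP ->; rewrite bgK.
have -> : [set y : {ffun 'I_n -> C} | [forall t, y t \in G (k, i) t]] :&:
    [set y : {ffun 'I_n -> C} | [forall t, y t \in G (l, j) t]] =
    [set y : {ffun 'I_n -> C} | [forall t, y t \in G (k, i) t :&: G (l, j) t]].
  apply/setP => y; rewrite !inE; apply/andP/forallP => [[/forallP h1 /forallP h2] t|H].
    by rewrite inE h1 h2.
  by split; apply/forallP => t; have := H t; rewrite inE => /andP[].
rewrite card_ffun_family (bigD1 i) //= (bigD1 j) 1?eq_sym //=.
rewrite (eq_bigr (fun=> #|C| - (#|bg k| + #|bg l|))%N); last first.
  move=> t /andP[/negbTE ti /negbTE tj]; rewrite /G /= ti tj -setCU cardsCs setCK.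
  rewrite cardsU (_ : _ :&: _ = set0) ?cards0 ?subn0 //.
  by apply/eqP; rewrite finset.setI_eq0; apply: bg_disj.
rewrite prod_nat_const.
have -> : #|[pred t | (t != i) && (t != j)]| = (n - 2)%N.
  have -> : #|[pred t | (t != i) && (t != j)]| = #|~: [set i; j]|.
    by apply: eq_card => t; rewrite !inE negb_or.
  by rewrite cardsCs setCK cards2 ij card_ord.
have Gi t : (#|G (k, i) t :&: G (l, j) t| <= 1)%N || ((t != i) && (t != j)).
  rewrite /G /=; case: eqVneq => [_|ti] /=.
    by rewrite orbF (leq_trans (subset_leq_card (finset.subsetIl _ _))) // cards1.
  case: eqVneq => [_|tj] /=; last by rewrite orbT.
  by rewrite orbF (leq_trans (subset_leq_card (finset.subsetIr _ _))) // cards1.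
have gi : (#|G (k, i) i :&: G (l, j) i| <= 1)%N by have := Gi i; rewrite eqxx orbF.
have gj : (#|G (k, i) j :&: G (l, j) j| <= 1)%N by have := Gi j; rewrite eqxx andbF orbF.
apply: (@leq_trans ((#|C| - (#|bg k| + #|bg l|)) ^ (n - 2) * #|C| ^ (n - 2))%N).
  rewrite leq_mul2r; apply/orP; right; rewrite mulnA -[leqRHS]mul1n leq_mul2r; apply/orP; right.
  by rewrite -[1%N]mul1n leq_mul.
rewrite -!expnMn; case: (n - 2)%N => [|e]; first by rewrite !expn0.
rewrite leq_exp2r //; move: #|C| #|bg k| #|bg l| => c x y.
have [/subnKC <-|h] := leqP (x + y) c; last by rewrite (eqP (ltnW h)).
move: (c - (x + y))%N => z.
by rewrite addKn -{2}addnA addKn [(x + y)%N]addnC -addnA addKn; nia.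
Qed.

Let c : R := #|C|%:R.
Let U : R := 1 - b%:R / c.

Let c0 : 0 < c. Proof. by rewrite ltr0n; apply: leq_ltn_trans bC. Qed.
Let U0 : 0 < U. Proof. by rewrite subr_gt0 ltr_pdivrMr // mul1r ltr_nat. Qed.

Let probA ki : ki.1 \in K ->
  #|A ki|%:R / c ^+ n = c^-1 * (1 - #|bg ki.1|%:R / c) ^+ n.-1.
Proof.
move=> kK; rewrite cardA // natrX natrB; last first.
  by apply: ltnW; apply: leq_ltn_trans (bgb kK) bC.
have -> : c ^+ n = c * c ^+ n.-1 by rewrite -exprS prednK // ltnW.
rewrite invfM mulrCA -expr_div_n mulrBl divff // gt_eqF //.
Qed.

Let U_le k : k \in K -> U <= 1 - #|bg k|%:R / c.
Proof. by move=> kK; rewrite lerB // ler_pM2r ?invr_gt0 // ler_nat bgb. Qed.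

(* The expected number of pairs (k, i) with [lonely k i] is at least [mu0], and
   these events are pairwise almost uncorrelated because the sets [bg k] are disjoint. *)
Lemma no_lonely_bound (mu0 : R) : 0 < mu0 ->
  mu0 <= #|K|%:R * n%:R / c * U ^+ n.-1 ->
  #|[set y | [forall k, forall i, ~~ lonely k i y]]|%:R / c ^+ n <=
    mu0^-1 + U ^- 2 - 1.
Proof.
move=> mu00 hmu0.
have cY : #|{: {ffun 'I_n -> C}}|%:R = c ^+ n by rewrite card_ffun card_ord natrX.
have Y0 : (0 < #|{: {ffun 'I_n -> C}}|)%N by rewrite -(ltr0n R) cY exprn_gt0.
pose mu : R := \sum_ki #|A ki|%:R / #|{: {ffun 'I_n -> C}}|%:R.
have hmu : mu0 <= mu.
  apply: (le_trans hmu0); rewrite /mu cY.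
  rewrite (bigID (fun ki : C * 'I_n => ki.1 \in K)) /= [X in _ + X]big1 ?addr0; last first.
    by move=> ki /A0 ->; rewrite cards0 mul0r.
  apply: (@le_trans _ _ (\sum_(ki : C * 'I_n | ki.1 \in K) (c^-1 * U ^+ n.-1))).
    rewrite sumr_const -[leRHS]mulr_natl.
    have -> : #|[pred ki : C * 'I_n | ki.1 \in K]| = (#|K| * n)%N.
      rewrite -[X in _ = (_ * X)%N](card_ord n) -cardsT -cardsX; apply: eq_card => -[k i].
      by rewrite !inE andbT.
    by rewrite natrM -!mulrA.
  apply: ler_sum => ki kK; rewrite probA // ler_wpM2l ?invr_ge0 ?(ltW c0) //.
  by apply: lerXn2r; rewrite ?nnegrE ?U_le ?(ltW U0) // (le_trans (ltW U0)) ?U_le.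
have -> : [set y | [forall k, forall i, ~~ lonely k i y]] =
    [set y | [forall ki, y \notin A ki]].
  apply/setP => y; rewrite !inE; apply/forallP/forallP => [H [k i]|H k].
    by have /forallP := H k; rewrite inE; apply.
  by apply/forallP => i; have := H (k, i); rewrite inE.
rewrite -cY.
apply: le_trans (second_moment Y0 (kappa := U ^- 2) (lt_le_trans mu00 hmu) _) _.
  case=> k i [l j]; rewrite cY.
  have [kK|kK] := boolP (k \in K); last first.
    rewrite (@A0 (k, i)) //= finset.set0I cards0 !(mul0r, mulr0) add0r.
    by rewrite ?(mul0r, mulr0).
  have [lK|lK] := boolP (l \in K); last first.
    rewrite (@A0 (l, j)) //= finset.setI0 cards0 !(mul0r, mulr0) addr0.
    by rewrite mulr_ge0 // divr_ge0 // exprn_ge0 // ltW.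
  have [->|ne] := eqVneq (k, i) (l, j).
    rewrite finset.setIid mul1r lerDl mulr_ge0 ?invr_ge0 ?exprn_ge0 ?(ltW U0) //.
    by rewrite mulr_ge0 // divr_ge0 // exprn_ge0 // ltW.
  rewrite mul0r add0r !probA //=.
  have := cardAA (ki := (k, i)) (lj := (l, j)) kK lK ne.
  rewrite -(ler_nat R) !natrM !natrX !natrB /= -/c; try by apply: ltnW; apply: leq_ltn_trans (bgb _) bC.
  set x := 1 - #|bg k|%:R / c; set z := 1 - #|bg l|%:R / c.
  have ex : c - #|bg k|%:R = c * x by rewrite mulrBr mulr1 mulrCA divff ?mulr1 // gt_eqF.
  have ez : c - #|bg l|%:R = c * z by rewrite mulrBr mulr1 mulrCA divff ?mulr1 // gt_eqF.
  have [Ux Uz] : U <= x /\ U <= z by rewrite !U_le.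
  have x0 : 0 < x := lt_le_trans U0 Ux; have z0 : 0 < z := lt_le_trans U0 Uz.
  have en : c ^+ n = c ^+ 2 * c ^+ (n - 2) by rewrite -exprD subnKC.
  have en1 w : w ^+ n.-1 = w * w ^+ (n - 2) :> R by rewrite -exprS -subSn // subSS subn1.
  rewrite ex ez !exprMn => h.
  have ck : 0 < c ^+ (n - 2) by rewrite exprn_gt0.
  have {}h : #|A (k, i) :&: A (l, j)|%:R <= x ^+ (n - 2) * (c ^+ (n - 2) * z ^+ (n - 2)).
    by rewrite -(ler_pM2r ck) (le_trans h) // le_eqVlt; apply/orP; left; apply/eqP; ring.
  rewrite en !en1 ler_pdivrMr ?mulr_gt0 ?exprn_gt0 //; apply: (le_trans h).
  (* The product of the two probabilities has one factor [x] and one factor [z] more than the bound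
     on the joint one. Both are at least [U], whence the choice of kappa as [U ^- 2]. *)
  have -> : U ^- 2 * (c^-1 * (x * x ^+ (n - 2)) * (c^-1 * (z * z ^+ (n - 2)))) * (c ^+ 2 * c ^+ (n - 2))
    = (x * z / U ^+ 2) * (x ^+ (n - 2) * (c ^+ (n - 2) * z ^+ (n - 2))).
    by field; rewrite !gt_eqF.
  apply: ler_peMl; first by rewrite !mulr_ge0 ?exprn_ge0 // ltW.
  by rewrite ler_pdivlMr ?exprn_gt0 // mul1r expr2 ler_pM // ltW.
by rewrite lerD2r lerD2r lef_pV2 // posrE // (lt_le_trans mu00).
Qed.

End IsolatedPoint.

(** * Probability that a window has many sparse cells *)

Lemma subset_of_card (T : finType) (A : {set T}) (k : nat) : (k <= #|A|)%N ->
  exists2 S : {set T}, S \subset A & #|S| = k.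
Proof.
move=> kA; exists [set x in take k (enum A)].
  by apply/fintype.subsetP => x; rewrite inE => /mem_take; rewrite mem_enum.
rewrite cardsE; have /card_uniqP -> := take_uniq k (enum_uniq A).
by rewrite size_takel // -cardE.
Qed.

Section Dense.
Context {R : realFieldType}.
Variables (n M : nat) (C : finType).
Implicit Types (y : {ffun 'I_n -> C}) (S : {set C}).

Definition dense_cells y : {set C} := [set c | M <= #|[set i | y i == c]|]%N.

(** Exponential Markov inequality: give each point in [S] the weight [th]. An assignment counted on
    the left has weight at least th^Q, and the total weight of all assignments factorizes over the
    points. *)
Lemma card_few_points (S : {set C}) (Q : nat) (th : R) : 0 < th <= 1 ->
  #|[set y : {ffun 'I_n -> C} | #|[set i | y i \in S]| <= Q]%N|%:R * th ^+ Q <=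
    (#|C|%:R - (1 - th) * #|S|%:R) ^+ n.
Proof.
move=> /andP[th0 th1].
pose w c : R := if c \in S then th else 1.
have -> : #|C|%:R - (1 - th) * #|S|%:R = \sum_c w c.
  rewrite (bigID (mem S)) /= (eq_bigr (fun=> th)); last by move=> c cS; rewrite /w cS.
  rewrite [X in _ = _ + X](eq_bigr (fun=> 1)); last by move=> c /negbTE cS; rewrite /w cS.
  rewrite !sumr_const -(cardC S) natrD.
  have -> : #|[pred i | i \notin S]| = #|[predC S]| by apply: eq_card.
  rewrite -[th *+ _]mulr_natl;
  by ring.
have -> : (\sum_c w c) ^+ n = \sum_(y : {ffun 'I_n -> C}) \prod_i w (y i).
  by rewrite -(bigA_distr_bigA (fun (i : 'I_n) c => w c)) /= prodr_const card_ord.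
set B := [set y | _]; rewrite -sum1_card natr_sum mulr_suml.
rewrite [leRHS](bigID (mem B)) /= -[leLHS]addr0; apply: lerD; last first.
  by apply: sumr_ge0 => y _; apply: prodr_ge0 => i _; rewrite /w; case: ifP => // _; apply: ltW.
apply: ler_sum => y; rewrite inE mul1r => hy.
have -> : \prod_i w (y i) = th ^+ #|[set i | y i \in S]|.
  rewrite /w -big_mkcond /= prodr_const; congr (_ ^+ _).
  by apply: eq_card => i; rewrite !inE.
by apply: ler_wiXn2l => //; apply: ltW.
Qed.

Lemma card_points_sparse y S : [disjoint S & dense_cells y] ->
  (#|[set i | y i \in S]| <= #|S| * M)%N.
Proof.
move=> SD.
have -> : #|[set i | y i \in S]| = (\sum_(c in S) #|[set i | y i == c]|)%N.
  rewrite -sum1_card (partition_big y (mem S)) /=; last by move=> i; rewrite inE.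
  apply: eq_bigr => c cS; rewrite -sum1_card; apply: eq_bigl => i.
  by rewrite !inE; case: eqVneq => [->|]; rewrite ?cS ?andbF.
rewrite -sum_nat_const; apply: leq_sum => c cS.
by have := disjointFr SD cS; rewrite inE => /negbT; rewrite -ltnNge => /ltnW.
Qed.

(** Union bound over the windows and over the sets of [k c] sparse cells in a window, at most 2^b of
    them; such a set contains at most [k c * M] points. *)
Lemma card_many_sparse (bx : C -> {set C}) (k : C -> nat) (b q : nat) (th : R) :
  0 < th <= 1 -> (forall c, #|bx c| <= b)%N -> (forall c, k c <= q)%N -> (q <= #|C|)%N ->
  #|[set y | [exists c, (k c <= #|bx c :\: dense_cells y|)%N]]|%:R <=
    2 ^+ b * th ^- (q * M) * \sum_c (#|C|%:R - (1 - th) * (k c)%:R) ^+ n.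
Proof.
move=> /[dup] hth /andP[th0 th1] hb hk qC.
pose F S := [set y : {ffun 'I_n -> C} | #|[set i | y i \in S]| <= #|S| * M]%N.
pose Z c := [set S : {set C} | (S \subset bx c) && (#|S| == k c)].
have sub : [set y | [exists c, (k c <= #|bx c :\: dense_cells y|)%N]] \subset
    \bigcup_c \bigcup_(S in Z c) F S.
  apply/fintype.subsetP => y; rewrite inE => /existsP[c /subset_of_card[S Sb Sk]].
  apply/bigcupP; exists c => //; apply/bigcupP; exists S.
    by rewrite inE Sk eqxx andbT (fintype.subset_trans Sb) // subsetDl.
  rewrite inE; apply: card_points_sparse; rewrite -setI_eq0.
  apply/eqP/setP => c'; rewrite in_setI in_set0; apply/negP => /andP[/(fintype.subsetP Sb)].
  by rewrite in_setD => /andP[/negbTE ->].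
have FS c S : S \in Z c -> #|F S|%:R <= th ^- (q * M) * (#|C|%:R - (1 - th) * (k c)%:R) ^+ n.
  rewrite inE => /andP[_ /eqP Sk].
  rewrite mulrC ler_pdivlMr ?exprn_gt0 // -Sk.
  apply: le_trans (card_few_points _ (#|S| * M) hth).
  rewrite ler_wpM2l //; apply: ler_wiXn2l => //; first exact: ltW.
  by rewrite leq_mul2r Sk hk orbT.
have ZS c : (#|Z c| <= 2 ^ b)%N.
  apply: (@leq_trans #|powerset (bx c)|).
    by apply: subset_leq_card; apply/fintype.subsetP => S; rewrite !inE => /andP[].
  by rewrite card_powerset leq_exp2l.
have bigU (I : finType) (P : pred I) (G : I -> {set {ffun 'I_n -> C}}) :
    #|\bigcup_(i | P i) G i|%:R <= \sum_(i | P i) #|G i|%:R :> R.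
  rewrite -natr_sum ler_nat; elim/big_rec2: _ => [|i m A _ IH]; first by rewrite cards0.
  by apply: leq_trans (leq_card_setU _ _) _; rewrite leq_add2l.
apply: (@le_trans _ _ #|\bigcup_c \bigcup_(S in Z c) F S|%:R).
  by rewrite ler_nat subset_leq_card.
apply: (le_trans (bigU _ _ _)); rewrite mulr_sumr; apply: ler_sum => c _.
apply: (le_trans (bigU _ _ _)).
apply: (@le_trans _ _ (\sum_(S in Z c) (th ^- (q * M) * (#|C|%:R - (1 - th) * (k c)%:R) ^+ n))).
  by apply: ler_sum => S; apply: FS.
have pos : 0 <= th ^- (q * M) * (#|C|%:R - (1 - th) * (k c)%:R) ^+ n.
  rewrite mulr_ge0 ?invr_ge0 ?exprn_ge0 ?(ltW th0) // subr_ge0.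
  apply: (@le_trans _ _ (k c)%:R); last by rewrite ler_nat (leq_trans (hk c)).
  by rewrite ler_piMl // gerBl ltW.
rewrite sumr_const -[leLHS]mulr_natl -mulrA ler_wpM2r // -natrX ler_nat ZS //.
Qed.

End Dense.

From mathcomp Require Import all_classical all_reals all_analysis.
From mathcomp Require Import measurable_realfun zify ring lra.
Import numFieldNormedType.Exports.
Local Open Scope classical_set_scope.
Local Open Scope ring_scope.

(** * The l_p norm and the area of its unit ball *)

Section LpNorm.
Context {R : realType}.
Implicit Types (p : \bar R) (x y : plane R) (a b t : R).

Lemma convex_powR_real (q t a b : R) : 1 <= q -> 0 <= t <= 1 -> 0 <= a -> 0 <= b ->
  (t * a + (1 - t) * b) `^ q <= t * a `^ q + (1 - t) * b `^ q.
Proof.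
move=> q1 /andP[t0 t1] a0 b0.
have := @convex_powR R q q1 (Itv01 t0 t1) a b.
by rewrite !inE /= !in_itv /= !andbT a0 b0 => /(_ isT isT).
Qed.

Lemma powR_div (q a b : R) : 0 <= a -> 0 < b -> (a / b) `^ q = a `^ q / b `^ q.
Proof.
move=> a0 b0; have b0' := ltW b0.
rewrite powRM ?invr_ge0 //; congr (_ * _).
by rewrite -[b^-1]powR_inv1 // powRAC powR_inv1 // powR_ge0.
Qed.

Lemma lp_norm_ge0 p x : (1 <= p)%E -> 0 <= lp_norm p x.
Proof.
by case: p => [q||] //= _; rewrite ?powR_ge0 // le_max normr_ge0.
Qed.

Lemma lp_norm_mono p x y : (1 <= p)%E ->
  `|x.1| <= `|y.1| -> `|x.2| <= `|y.2| -> lp_norm p x <= lp_norm p y.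
Proof.
case: p => [q||_ _ _]; last exact: lexx.
  2: move=> _ h1 h2.
  2: by rewrite /lp_norm ge_max; apply/andP; split; rewrite le_max ?h1 ?h2 ?orbT.
rewrite /lp_norm.
rewrite lee_fin => q1 h1 h2; have q0 : 0 <= q by lra.
apply: ge0_ler_powR; rewrite ?invr_ge0 ?nnegrE ?addr_ge0 ?powR_ge0 //.
by apply: lerD; apply: ge0_ler_powR; rewrite ?nnegrE.
Qed.

Lemma lp_norm_scale p t x : (1 <= p)%E -> 0 <= t ->
  lp_norm p (t * x.1, t * x.2) = t * lp_norm p x.
Proof.
case: p => [q|_ t0|] //=; last by rewrite !normrM !(ger0_norm t0) maxr_pMr.
rewrite lee_fin => q1 t0; have q0 : q != 0 by rewrite gt_eqF //; lra.
rewrite !normrM !(ger0_norm t0) !powRM // -mulrDr powRM ?addr_ge0 ?powR_ge0 //.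
by rewrite -powRrM mulfV // powRr1.
Qed.

Lemma lp_norm_powR (q : R) x : 1 <= q ->
  lp_norm q%:E x `^ q = `|x.1| `^ q + `|x.2| `^ q.
Proof.
move=> q1 /=; have q0 : q != 0 by rewrite gt_eqF //; lra.
by rewrite -powRrM mulVf // powRr1 // addr_ge0 ?powR_ge0.
Qed.

Lemma powR_invK (q a : R) : 1 <= q -> 0 <= a -> (a `^ q) `^ q^-1 = a.
Proof.
move=> q1 a0; have q0 : q != 0 by rewrite gt_eqF //; lra.
by rewrite -powRrM mulfV // powRr1.
Qed.

Lemma lp_norm_ge1 p x : (1 <= p)%E -> `|x.1| <= lp_norm p x.
Proof.
case: p => [q|_|] //=; last by rewrite le_max lexx.
rewrite lee_fin => q1; have q0 : 0 <= q^-1 by rewrite invr_ge0; lra.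
rewrite -{1}(powR_invK q1 (normr_ge0 x.1)).
by rewrite ge0_ler_powR ?nnegrE ?addr_ge0 ?powR_ge0 // lerDl powR_ge0.
Qed.

Lemma lp_norm_ge2 p x : (1 <= p)%E -> `|x.2| <= lp_norm p x.
Proof.
case: p => [q|_|] //=; last by rewrite le_max lexx orbT.
rewrite lee_fin => q1; have q0 : 0 <= q^-1 by rewrite invr_ge0; lra.
rewrite -{1}(powR_invK q1 (normr_ge0 x.2)).
by rewrite ge0_ler_powR ?nnegrE ?addr_ge0 ?powR_ge0 // lerDr powR_ge0.
Qed.

(** Minkowski's inequality from the convexity of the power: if [a] and [b] are the two norms, (|u| +
    |v|) / (a + b) is the convex combination of |u| / a and |v| / b with weights a / (a + b) and b /
    (a + b). Vanishing norms are treated apart because of the divisions. *)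
Lemma lp_norm_triangle p x y : (1 <= p)%E ->
  lp_norm p (x.1 + y.1, x.2 + y.2) <= lp_norm p x + lp_norm p y.
Proof.
move=> hp; have [a0|a0] := eqVneq (lp_norm p x) 0.
  rewrite a0 add0r; apply: lp_norm_mono => //=.
    have := lp_norm_ge1 x hp; rewrite a0 normr_le0 => /eqP ->; by rewrite add0r.
  have := lp_norm_ge2 x hp; rewrite a0 normr_le0 => /eqP ->; by rewrite add0r.
have [b0|b0] := eqVneq (lp_norm p y) 0.
  rewrite b0 addr0; apply: lp_norm_mono => //=.
    have := lp_norm_ge1 y hp; rewrite b0 normr_le0 => /eqP ->; by rewrite addr0.
  have := lp_norm_ge2 y hp; rewrite b0 normr_le0 => /eqP ->; by rewrite addr0.
have {}a0 : 0 < lp_norm p x by rewrite lt0r a0 lp_norm_ge0.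
have {}b0 : 0 < lp_norm p y by rewrite lt0r b0 lp_norm_ge0.
case: p hp a0 b0 => [q|_ _ _|] //; last first.
  rewrite /= ge_max !(le_trans (ler_normD _ _)) //; apply: lerD;
  by rewrite le_max lexx ?orbT.
rewrite lee_fin => q1.
have hx := lp_norm_powR x q1; have hy := lp_norm_powR y q1.
move: hx hy; move: (lp_norm _ x) (lp_norm _ y) => a b hx hy a0 b0.
have s0 : 0 < a + b by lra.
have q0 : 0 <= q by lra.
have key (u v : R) : `|u + v| `^ q <=
    (a + b) `^ q * (a / (a + b) * (`|u| `^ q / a `^ q) + b / (a + b) * (`|v| `^ q / b `^ q)).
  have -> : `|u| `^ q / a `^ q = (`|u| / a) `^ q.
    by rewrite powR_div.
  have -> : `|v| `^ q / b `^ q = (`|v| / b) `^ q.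
    by rewrite powR_div.
  have -> : b / (a + b) = 1 - a / (a + b) by field; lra.
  apply: (@le_trans _ _ ((a + b) `^ q *
     (a / (a + b) * (`|u| / a) + (1 - a / (a + b)) * (`|v| / b)) `^ q)).
    have -> : a / (a + b) * (`|u| / a) + (1 - a / (a + b)) * (`|v| / b) = (`|u| + `|v|) / (a + b).
      by field; lra.
    rewrite -powRM ?divr_ge0 ?addr_ge0 //; try by rewrite ltW.
    have -> : (a + b) * ((`|u| + `|v|) / (a + b)) = `|u| + `|v| by field; lra.
    by apply: ge0_ler_powR; rewrite ?nnegrE ?addr_ge0 ?ler_normD.
  rewrite ler_wpM2l ?powR_ge0 //; apply: convex_powR_real => //.
  - by rewrite divr_ge0 ?(ltW a0) ?(ltW s0) //= ler_pdivrMr //; lra.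
  - by rewrite divr_ge0 // ltW.
  - by rewrite divr_ge0 // ltW.
have aq : 0 < a `^ q by rewrite powR_gt0.
have bq : 0 < b `^ q by rewrite powR_gt0.
have /= H := lerD (key x.1 y.1) (key x.2 y.2).
suff h : `|x.1 + y.1| `^ q + `|x.2 + y.2| `^ q <= (a + b) `^ q.
  rewrite -(powR_invK q1 (ltW s0)) /=; apply: ge0_ler_powR => //.
  - by rewrite invr_ge0.
  - by rewrite nnegrE addr_ge0 ?powR_ge0.
  - by rewrite nnegrE powR_ge0.
apply: (le_trans H); rewrite -mulrDr -[leRHS]mulr1 ler_wpM2l ?powR_ge0 //.
rewrite addrACA -!mulrDr -!mulrDl -hx -hy !mulfV ?gt_eqF // !mulr1 -mulrDl mulfV //.
by rewrite gt_eqF.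
Qed.

Lemma lp_norm_le_sum p x : (1 <= p)%E -> lp_norm p x <= `|x.1| + `|x.2|.
Proof.
move=> hp.
have axis1 a : lp_norm p (a, 0) <= `|a|.
  case: p hp => [q|_|] //=; last by rewrite normr0 ge_max lexx normr_ge0.
  rewrite lee_fin => q1; rewrite normr0 powR0 ?addr0 ?powR_invK // gt_eqF //; lra.
have axis2 a : lp_norm p (0, a) <= `|a|.
  case: p hp {axis1} => [q|_|] //=; last by rewrite normr0 ge_max lexx normr_ge0.
  rewrite lee_fin => q1; rewrite normr0 powR0 ?add0r ?powR_invK // gt_eqF //; lra.
have := lp_norm_triangle (x.1, 0) (0, x.2) hp; rewrite /= addr0 add0r => h.
have <- : (x.1, x.2) = x by case: x {h}.
exact: le_trans h (lerD (axis1 _) (axis2 _)).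
Qed.

Lemma measurable_lp_norm p : measurable_fun [set: plane R] (lp_norm p).
Proof.
have m1 : measurable_fun [set: plane R] (fun x : plane R => `|x.1|).
  by apply: measurableT_comp => //; exact: measurable_fst.
have m2 : measurable_fun [set: plane R] (fun x : plane R => `|x.2|).
  by apply: measurableT_comp => //; exact: measurable_snd.
case: p => [q||] /=.
- apply: (@measurableT_comp _ _ _ _ _ _ (@powR R ^~ q^-1)); first exact: measurable_powR.
  apply: measurable_funD.
    by apply: (@measurableT_comp _ _ _ _ _ _ (@powR R ^~ q)) => //; exact: measurable_powR.
  by apply: (@measurableT_comp _ _ _ _ _ _ (@powR R ^~ q)) => //; exact: measurable_powR.
- exact: measurable_maxr.
- exact: measurable_cst.
Qed.

End LpNorm.

(** * Measure bounds from packings and coverings by sets of equal measure *)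

Section FiniteUnions.
Context {d : measure_display} {T : measurableType d} {R : realType}.
Variables (mu : {measure set T -> \bar R}) (I : finType) (B : {set I}).
Variables (F : I -> set T) (A : set T) (a : R).
Hypotheses (mF : forall i, measurable (F i)) (mA : measurable A).
Hypothesis (Fa : forall i, i \in B -> mu (F i) = a%:E).

Let sumF : (\sum_(i \in [set` B]) mu (F i) = (#|B|%:R * a)%:E)%E.
Proof.
have -> : [set` B] = [set` enum B].
  by apply/seteqP; split => i /=; rewrite mem_enum.
rewrite -fsbig_seq ?enum_uniq // big_enum /=.
rewrite (eq_bigr (fun=> a%:E)); last by move=> i; apply: Fa.
by rewrite sumEFin sumr_const mulr_natl.
Qed.

Lemma measure_ge_disjoint : trivIset [set` B] F ->
  (forall i, i \in B -> F i `<=` A) -> ((#|B|%:R * a)%:E <= mu A)%E.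
Proof.
move=> tF FA; rewrite -sumF -measure_fin_bigcup //.
apply: le_measure; rewrite ?inE //.
  by apply: fin_bigcup_measurable.
by move=> x [i /= iB]; apply: FA.
Qed.

Lemma measure_le_cover : A `<=` \bigcup_(i in [set` B]) F i ->
  (mu A <= (#|B|%:R * a)%:E)%E.
Proof. by move=> AF; rewrite -sumF; apply: content_sub_fsum. Qed.

End FiniteUnions.

Section Squares.
Context {R : realType}.
Implicit Types (h : R) (i j : int).

(** The [x] for which [i] is the floor of [h * x]; the width is 1 / h. It is used with h = rho - 4
    and h = rho + 4 to pave the disk, and with h = m for the cells. *)
Definition slab h i : set (measurableTypeR R) := [set x | i%:~R <= h * x < (i + 1)%:~R].

Definition square h i j : set (plane R) := slab h i `*` slab h j.

Lemma slabE h i : 0 < h -> slab h i = `[i%:~R / h, (i + 1)%:~R / h[%classic.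
Proof.
move=> h0; apply/seteqP; split => x; rewrite /slab /= in_itv /=;
  by rewrite ler_pdivrMr // ltr_pdivlMr // [x * h]mulrC.
Qed.

Lemma measurable_slab h i : 0 < h -> measurable (slab h i).
Proof. by move=> h0; rewrite slabE //; exact: measurable_itv. Qed.

Lemma lebesgue_slab h i : 0 < h -> lebesgue_measure (slab h i) = h^-1%:E :> \bar R.
Proof.
move=> h0; rewrite slabE // lebesgue_measure_itv /= lte_fin.
rewrite ltr_pM2r ?invr_gt0 // ltr_int ltrDl ltr01.
by rewrite -EFinD -mulrBl -intrB addrC addKr mul1r.
Qed.

Lemma measurable_square h i j : 0 < h -> measurable (square h i j).
Proof. by move=> h0; apply: measurableX; apply: measurable_slab. Qed.

Lemma area_square h i j : 0 < h -> area (square h i j) = (h ^- 2)%:E.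
Proof.
move=> h0; rewrite /area product_measure1E; try exact: measurable_slab.
by rewrite [X in (X * _)%E]lebesgue_slab // [X in (_ * X)%E]lebesgue_slab // -EFinM -expr2 exprVn.
Qed.

Lemma slab_inj h i j (x : R) : slab h i x -> slab h j x -> i = j.
Proof.
by rewrite /slab /= => /floor_def <- /floor_def <-.
Qed.

Lemma trivIset_squares (I : Type) (D : set I) h (f : I -> int * int) : injective f ->
  trivIset D (fun k => square h (f k).1 (f k).2).
Proof.
move=> finj k l _ _ [x [[/= k1 k2] [/= l1 l2]]]; apply: finj.
by rewrite [f k]surjective_pairing [f l]surjective_pairing (slab_inj k1 l1) (slab_inj k2 l2).
Qed.

Lemma measurable_lp_ball (p : \bar R) : measurable [set x : plane R | lp_norm p x <= 1].
Proof.
have := @measurable_lp_norm R p measurableT `]-oo, 1]%classic (measurable_itv _).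
by rewrite setTI; congr measurable; apply/seteqP; split => x /=; rewrite in_itv.
Qed.

End Squares.

(** * The area of the disk compared with counts of cells *)

Section BallArea.
Context {R : realType}.
Variables (p : \bar R) (hp : (1 <= p)%E).

(* For two cells at coordinate distances [a] and [b], [near] suffices for all pairs of
   their points to be at distance at most [rho] times the side of a cell, and [touch]
   is necessary for some pair to be. *)
Definition near (rho : R) : rel nat := fun a b => lp_norm p (a.+1%:R, b.+1%:R) <= rho.
Definition touch (rho : R) : rel nat := fun a b => lp_norm p (a.-1%:R, b.-1%:R) <= rho.

(** For every p the vector (2, 2) has norm at most 4: this is the origin of the 4 in rho - 4 and rho
    + 4. *)
Lemma lp_norm_add2 (x y : plane R) : `|y.1| <= `|x.1| + 2 -> `|y.2| <= `|x.2| + 2 ->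
  lp_norm p y <= lp_norm p x + 4.
Proof.
move=> h1 h2.
apply: (@le_trans _ _ (lp_norm p (`|x.1| + 2, `|x.2| + 2))).
  by apply: lp_norm_mono => //=; rewrite [leRHS]ger0_norm // addr_ge0.
have := @lp_norm_triangle R p (`|x.1|, `|x.2|) (2, 2) hp.
move=> /le_trans; apply; apply: lerD.
  by apply: lp_norm_mono => //=; rewrite normr_id.
by apply: (le_trans (lp_norm_le_sum _ hp)); rewrite /= ger0_norm //; lra.
Qed.

(** [Negz a] is -(a + 1), so for both signs the unit interval starting at this integer has distance
    [a] from 0. One pair of naturals thus serves all four quadrants. *)
Definition sgn_int (s : bool) (a : nat) : int := if s then Posz a else Negz a.

Lemma floor_sgn (z : R) : exists s a, Num.floor z = sgn_int s a /\ a%:R <= `|z|.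
Proof.
have := floor_itv z; case: (Num.floor z) => k /andP[h1 h2].
  by exists true, k; split=> //; apply: le_trans (ler_norm _).
exists false, k; split => //; rewrite -normrN; apply: le_trans (ler_norm _).
by move: h2; rewrite NegzE -addn1 PoszD opprD addrK intrN lerNr; apply: ltW.
Qed.

Definition near_count (rho : R) (N : nat) : nat :=
  #|[set ab : 'I_N * 'I_N | near rho ab.1.+1 ab.2.+1]%SET|.

(** Scale the disk to radius rho - 4. A unit square that meets it at distances (a, b) from the axes
    satisfies [near] for (a + 1, b + 1), where the norm is that of (a + 2, b + 2). The factor 4
    counts the quadrants. *)
Lemma ball_area_le_cover (rho : R) (N : nat) : 4 < rho -> rho <= N%:R ->
  (area [set x : plane R | (lp_norm p x <= 1)%R] <=
     ((4 * near_count rho N)%:R * (rho - 4) ^- 2)%R%:E)%E.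
Proof.
move=> r4 rN; have h0 : 0 < rho - 4 by lra.
pose Q := [set ab : 'I_N * 'I_N | near rho ab.1.+1 ab.2.+1]%SET.
pose B : {set (bool * bool) * ('I_N * 'I_N)} := finset.setX [set: bool * bool]%SET Q.
have -> : (4 * near_count rho N = #|B|)%N.
  by rewrite cardsX cardsT card_prod card_bool.
rewrite /area.
apply: (@measure_le_cover _ _ _ (lebesgue_measure \x lebesgue_measure)%E _ B (fun k => square (rho - 4)
   (sgn_int k.1.1 k.2.1) (sgn_int k.1.2 k.2.2))).
- by move=> k; apply: measurable_square.
- exact: measurable_lp_ball.
- by move=> k _; apply: area_square.
move=> x /= x1.
have [s [a [fa ha]]] := floor_sgn ((rho - 4) * x.1).
have [t [b [fb hb]]] := floor_sgn ((rho - 4) * x.2).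
have hx : lp_norm p ((rho - 4) * x.1, (rho - 4) * x.2) <= rho - 4.
  by rewrite lp_norm_scale ?(ltW h0) // -[leRHS]mulr1 ler_wpM2l // ltW.
have aN : (a < N)%N.
  rewrite -(ltr_nat R); apply: le_lt_trans ha _.
  by have /= := le_trans (lp_norm_ge1 _ hp) hx; lra.
have bN : (b < N)%N.
  rewrite -(ltr_nat R); apply: le_lt_trans hb _.
  by have /= := le_trans (lp_norm_ge2 _ hp) hx; lra.
exists ((s, t), (Ordinal aN, Ordinal bN)) => /=.
  rewrite !inE /= /near.
  apply: (le_trans (lp_norm_add2 (x := ((rho - 4) * x.1, (rho - 4) * x.2)) _ _)).
  - by rewrite /= ger0_norm // -addn2 natrD lerD2r.
  - by rewrite /= ger0_norm // -addn2 natrD lerD2r.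
  by move: hx; lra.
by split; rewrite /slab /= -?fa -?fb floor_itv.
Qed.

Lemma ball_area_fin : area [set x : plane R | lp_norm p x <= 1] = (lp_ball_area p)%:E.
Proof.
rewrite /lp_ball_area fineK // ge0_fin_numE //.
(* Any rho above 4 excludes an infinite area. *)
by apply: le_lt_trans (@ball_area_le_cover 5 5 _ _) (ltry _); lra.
Qed.

Lemma lp_ball_area_le (rho : R) (N : nat) : 4 < rho -> rho <= N%:R ->
  lp_ball_area p * (rho - 4) ^+ 2 <= 4 * (near_count rho N)%:R.
Proof.
move=> r4 rN; have := ball_area_le_cover r4 rN.
by rewrite ball_area_fin lee_fin natrM ler_pdivlMr // exprn_gt0 // subr_gt0.
Qed.

(** The unit squares of the cells that touch [c], translated by [c], fit into the disk of radius rho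
    + 4: a square at coordinate distance k reaches at most k + 1, which exceeds the k.-1 of [touch]
    by at most 2. *)
Lemma lp_ball_area_ge (rho : R) (m : nat) (c : 'I_m * 'I_m) : 0 <= rho ->
  #|[set v | cell_adj (touch rho) c v]%SET|%:R <= lp_ball_area p * (rho + 4) ^+ 2.
Proof.
move=> r0; have h0 : 0 < rho + 4 by lra.
rewrite -ler_pdivrMr ?exprn_gt0 // -lee_fin -ball_area_fin.
pose f (v : 'I_m * 'I_m) : int * int := ((v.1 : nat)%:Z - (c.1 : nat)%:Z, (v.2 : nat)%:Z - (c.2 : nat)%:Z).
rewrite /area.
apply: (@measure_ge_disjoint _ _ _ (lebesgue_measure \x lebesgue_measure)%E _ _
  (fun v => square (rho + 4) (f v).1 (f v).2)).
- by move=> k; apply: measurable_square.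
- exact: measurable_lp_ball.
- by move=> k _; apply: area_square.
- by apply: trivIset_squares => -[u1 u2] [v1 v2] [] /= e1 e2; congr (_, _); apply: val_inj => /=; lia.
move=> v; rewrite inE /cell_adj /touch => hv x [/= h1 h2].
have key (i j : nat) (z : R) : slab (rho + 4) (Posz j - Posz i) z ->
    `|(rho + 4) * z| <= `|(ndist i j).-1%:R : R| + 2.
  rewrite /slab /= => /andP[k1 k2]; rewrite (ger0_norm (ler0n _ _)).
  have H : (ndist i j)%:R <= (ndist i j).-1%:R + 1 :> R.
    by rewrite natr1 ler_nat; lia.
  have H1 : (Posz j - Posz i)%:~R <= (ndist i j)%:R :> R.
    by rewrite pmulrn ler_int /ndist; lia.
  have H2 : - (ndist i j)%:R <= (Posz j - Posz i)%:~R :> R.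
    by rewrite pmulrn -intrN ler_int /ndist; lia.
  by rewrite ler_norml; move: k1 k2; rewrite intrD; lra.
rewrite -(ler_pM2l h0) mulr1 -lp_norm_scale //; last lra.
have := @lp_norm_add2 ((ndist c.1 v.1).-1%:R, (ndist c.2 v.2).-1%:R) ((rho + 4) * x.1, (rho + 4) * x.2).
by move=> /(_ (key _ _ _ h1) (key _ _ _ h2)); move: hv; lra.
Qed.

(** In a grid with a single cell, this cell touches itself even for rho = 0. *)
Lemma lp_ball_area_gt0 : 0 < lp_ball_area p.
Proof.
have := @lp_ball_area_ge 0 1 (ord0, ord0) (lexx _).
have -> : #|[set v | cell_adj (touch 0) (@ord0 0, @ord0 0) v]%SET| = 1%N.
  apply: (etrans _ (card1 (@ord0 0, @ord0 0))); apply: eq_card => -[u v].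
  rewrite !inE !ord1 /= eqxx /cell_adj /touch /ndist /=.
  by apply: (le_trans (lp_norm_le_sum _ hp)); rewrite /= !normr0 addr0.
by move=> h; nra.
Qed.

End BallArea.

(** * From points to cells *)

Lemma eq_hamiltonian (V : finType) (e e' : rel V) : e =2 e' -> hamiltonian e -> hamiltonian e'.
Proof.
move=> ee' [c [c2 /andP[cc uc] cv]]; exists c; split => //.
by rewrite /ucycle uc andbT -(eq_cycle ee').
Qed.

Lemma hamiltonian_mono (V : finType) (e e' : rel V) : subrel e e' ->
  hamiltonian e -> hamiltonian e'.
Proof.
move=> ee' [c [c2 /andP[cc uc] cv]]; exists c; split => //.
by rewrite /ucycle uc andbT (sub_cycle ee').
Qed.

Lemma hamiltonian_neighbour (V : finType) (e : rel V) (v : V) :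
  hamiltonian e -> exists w, e v w.
Proof. by case=> c [_ /andP[cc _] cv]; exists (next c v); apply: next_cycle. Qed.

Section CellsToPoints.
Context {R : realType}.
Variables (p : \bar R) (hp : (1 <= p)%E) (m : nat).
Hypothesis m0 : (0 < m)%N.

Definition cell_square (u : 'I_m * 'I_m) : set (plane R) := square m%:R (u.1 : nat) (u.2 : nat).

Let mR0 : 0 < m%:R :> R. Proof. by rewrite ltr0n. Qed.

Lemma slab_dist (i j : nat) (x y : R) :
  slab m%:R (Posz i) x -> slab m%:R (Posz j) y ->
  (ndist i j).-1%:R <= m%:R * `|x - y| <= (ndist i j).+1%:R.
Proof.
rewrite /slab /= !intrD -!pmulrn => /andP[x1 x2] /andP[y1 y2].
have -> : m%:R * `|x - y| = `|m%:R * x - m%:R * y|.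
  by rewrite -mulrBr normrM (ger0_norm (ltW mR0)).
have H1 : (ndist i j).-1%:R <= Num.max 0 (Num.max (i%:R - j%:R - 1) (j%:R - i%:R - 1)) :> R.
  rewrite /ndist !le_max; case: (ltngtP i j) => hij.
  - apply/orP; right; apply/orP; right.
    by rewrite !lerBrDr natr1 -natrD ler_nat; lia.
  - apply/orP; right; apply/orP; left.
    by rewrite !lerBrDr natr1 -natrD ler_nat; lia.
  - by rewrite hij subnn lexx.
have H2 : i%:R - j%:R <= (ndist i j)%:R :> R.
  by rewrite lerBlDr -natrD ler_nat /ndist; lia.
have H3 : j%:R - i%:R <= (ndist i j)%:R :> R.
  by rewrite lerBlDr -natrD ler_nat /ndist; lia.
apply/andP; split; last first.
  by rewrite -natr1 ler_norml; apply/andP; split; lra.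
apply: (le_trans H1); rewrite !ge_max normr_ge0 /=; apply/andP; split.
  by apply: le_trans (ler_norm _); lra.
by rewrite distrC; apply: le_trans (ler_norm _); lra.
Qed.

Lemma lp_dist_scale (x y : plane R) :
  m%:R * lp_dist p x y = lp_norm p (m%:R * `|x.1 - y.1|, m%:R * `|x.2 - y.2|).
Proof.
rewrite /lp_dist (lp_norm_scale (`|x.1 - y.1|, `|x.2 - y.2|) hp (ltW mR0)).
by congr (_ * _); apply/le_anti/andP; split; apply: lp_norm_mono; rewrite //= normr_id.
Qed.

Lemma near_dist (rho r : R) (u v : 'I_m * 'I_m) (x y : plane R) : rho <= r * m%:R ->
  cell_adj (near p rho) u v -> cell_square u x -> cell_square v y -> lp_dist p x y <= r.
Proof.
move=> hr huv [/= x1 x2] [/= y1 y2]; rewrite -(ler_pM2l mR0) [leRHS]mulrC.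
apply: le_trans hr; rewrite lp_dist_scale; apply: le_trans huv.
have /andP[_ h1] := slab_dist x1 y1; have /andP[_ h2] := slab_dist x2 y2.
by apply: lp_norm_mono => //=; rewrite normrM normr_id (ger0_norm (ltW mR0)) (ger0_norm (ler0n _ _)).
Qed.

Lemma touch_dist (rho r : R) (u v : 'I_m * 'I_m) (x y : plane R) : r * m%:R <= rho ->
  lp_dist p x y <= r -> cell_square u x -> cell_square v y -> cell_adj (touch p rho) u v.
Proof.
move=> hr hd [/= x1 x2] [/= y1 y2]; apply: le_trans hr.
move: hd; rewrite -(ler_pM2l mR0) [leRHS]mulrC; apply: le_trans; rewrite lp_dist_scale.
have /andP[h1 _] := slab_dist x1 y1; have /andP[h2 _] := slab_dist x2 y2.
by apply: lp_norm_mono => //=; rewrite normrM normr_id (ger0_norm (ltW mR0)) (ger0_norm (ler0n _ _)).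
Qed.

Lemma cell_square_sub (u : 'I_m * 'I_m) : cell_square u `<=` unit_square.
Proof.
have key (i : 'I_m) (z : R) : slab m%:R (i : nat) z -> 0 <= z <= 1.
  rewrite /slab /= intrD -!pmulrn => /andP[h1 h2].
  have h3 : (i : nat)%:R + 1 <= m%:R :> R by rewrite natr1 ler_nat.
  apply/andP; split.
    by rewrite -(ler_pM2l mR0) mulr0; apply: le_trans h1.
  by rewrite -(ler_pM2l mR0) mulr1; lra.
by move=> x [/= h1 h2]; rewrite /unit_square /= (key _ _ h1) (key _ _ h2).
Qed.

Context {d : measure_display} {T : measurableType d} (P : probability T R).
Variables (n : nat) (X : 'I_n -> {RV P >-> plane R}).
Hypothesis hX : iid_uniform_points X.

(* Only an inequality, because the half-open cells do not cover the edges of the square. *)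
Lemma cells_prob (B : {set {ffun 'I_n -> 'I_m * 'I_m}}) (E : set T) : measurable E ->
  (forall y w, y \in B -> (forall i, cell_square (y i) (X i w)) -> E w) ->
  ((#|B|%:R / (m%:R ^+ 2) ^+ n)%:E <= P E)%E.
Proof.
move=> mE HE.
pose F (y : {ffun 'I_n -> 'I_m * 'I_m}) : set T :=
  \bigcap_(i in [set` [set: 'I_n]%SET]) (X i @^-1` cell_square (y i)).
have iT (i : 'I_n) : [set` [set: 'I_n]%SET] i by rewrite /= inE.
have mQ u : measurable (cell_square u) by apply: measurable_square.
have mpre (i : 'I_n) u : measurable (X i @^-1` cell_square u).
  by rewrite -[X in measurable X]setTI; apply: measurable_funP.
apply: (@measure_ge_disjoint _ _ _ P _ B F E) => //.
- by move=> y; apply: fin_bigcap_measurable.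
- move=> y _; rewrite /F; case: hX => hU hI.
  apply: (etrans (hI [set: 'I_n]%SET (fun i => cell_square (y i)) (fun i => mQ _))).
  rewrite (eq_bigr (fun=> (m%:R ^- 2)%:E)); last first.
    move=> i _; rewrite -[LHS]/(distribution P (X i) (cell_square (y i))) hU //.
    by rewrite (setIidl (@cell_square_sub _)) area_square.
  by rewrite prodEFin prodr_const cardsT card_ord exprVn.
- move=> y z _ _ [w [hy hz]]; apply/ffunP => i.
  have [/= a1 a2] := hy i (iT i); have [/= b1 b2] := hz i (iT i).
  have e1 := slab_inj a1 b1; have e2 := slab_inj a2 b2.
  rewrite [y i]surjective_pairing [z i]surjective_pairing.
  by congr (_, _); apply: val_inj; case: e1 e2 => ? [].
- by move=> y yB w /= hw; apply: (HE y) => // i; apply: hw.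
Qed.

(** The event is a finite union, over the Hamiltonian graphs [g], of the events that the random
    graph equals [g]; each of these is a finite intersection of conditions on single distances. *)
Lemma measurable_hamiltonian (r : R) :
  measurable [set w | hamiltonian (geometric_graph p r (fun i => X i w))].
Proof.
pose A (g : {ffun 'I_n * 'I_n -> bool}) : set T :=
  \bigcap_(ij in [set: 'I_n * 'I_n])
    [set w | geometric_graph p r (fun i => X i w) ij.1 ij.2 = g ij].
have -> : [set w | hamiltonian (geometric_graph p r (fun i => X i w))] =
    \bigcup_(g in [set g : {ffun 'I_n * 'I_n -> bool} | hamiltonian (fun i j => g (i, j))]) A g.
  apply/seteqP; split => w /=.
    move=> hw; exists [ffun ij => geometric_graph p r (fun i => X i w) ij.1 ij.2] => /=.
      by apply: eq_hamiltonian hw => i j; rewrite ffunE.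
    by move=> ij _ /=; rewrite ffunE.
  by case=> g /= hg Ag; apply: eq_hamiltonian hg => i j; rewrite -(Ag (i, j)).
apply: fin_bigcup_measurable => // g _; apply: fin_bigcap_measurable => // -[i j] _ /=.
have mD : measurable [set w | lp_dist p (X i w) (X j w) <= r].
  have mf : measurable_fun [set: T] (fun w => lp_dist p (X i w) (X j w)).
    apply: (measurableT_comp (@measurable_lp_norm R p)).
    have mX k : measurable_fun [set: T] (X k) by [].
    apply/measurable_fun_pair; apply: measurable_funB;
      by apply: measurableT_comp => //; first [exact: measurable_fst | exact: measurable_snd].
  have := mf measurableT `]-oo, r]%classic (measurable_itv _).
  by rewrite setTI; congr measurable; apply/seteqP; split => x /=; rewrite in_itv.
rewrite /geometric_graph; case: eqVneq => _ /=.
  case: (g _).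
    by have -> : [set _ : T | false = true] = set0 by apply/seteqP; split.
  by have -> : [set _ : T | false = false] = setT by apply/seteqP; split.
case: (g _); first exact: mD.
have -> : [set w | (lp_dist p (X i w) (X j w) <= r) = false] =
    ~` [set w | lp_dist p (X i w) (X j w) <= r].
  by apply/seteqP; split => w /= h; [apply/negP; rewrite h | apply/negbTE/negP].
exact: measurableC.
Qed.

End CellsToPoints.

(** * Below the threshold *)

Section Centres.
Local Open Scope nat_scope.

Definition centres (W m : nat) : {set 'I_m * 'I_m} :=
  [set c : 'I_m * 'I_m | (W %| c.1) && (W %| c.2)]%SET.

(** Rounding down m / W at most halves it, as W <= m. *)
Lemma card_centres (W m : nat) : 0 < W -> W <= m -> m ^ 2 <= #|centres W m| * (2 * W) ^ 2.
Proof.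
move=> W0 Wm.
have k0 : 0 < m %/ W by rewrite divn_gt0.
have hlt (a : 'I_(m %/ W)) : a * W < m.
  by apply: leq_trans (leq_trunc_div m W); rewrite ltn_pmul2r.
have mk : m <= m %/ W * (2 * W).
  by have := divn_eq m W; have := ltn_pmod m W0; move: k0; clear; nia.
have : (m %/ W) ^ 2 <= #|centres W m|.
  have -> : (m %/ W) ^ 2 = #|{: 'I_(m %/ W) * 'I_(m %/ W)}| by rewrite card_prod !card_ord.
  pose f (ab : 'I_(m %/ W) * 'I_(m %/ W)) : 'I_m * 'I_m :=
    (Ordinal (hlt ab.1), Ordinal (hlt ab.2)).
  rewrite -(@card_imset _ _ f) => [|[a a'] [b b'] []].
    apply: subset_leq_card; apply/fintype.subsetP => c /imsetP[ab _ ->].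
    by rewrite inE /= !dvdn_mull.
  move=> /eqP; rewrite eqn_pmul2r // => /eqP/val_inj -> /eqP.
  by rewrite eqn_pmul2r // => /eqP/val_inj ->.
move=> h; apply: (@leq_trans ((m %/ W) ^ 2 * (2 * W) ^ 2)); last by rewrite leq_mul2r h orbT.
by rewrite -expnMn leq_exp2r.
Qed.

Lemma dvdn_close (W a b : nat) : W %| a -> W %| b -> ndist a b < W -> a = b.
Proof.
move=> Wa Wb; rewrite /ndist; wlog ab : a b Wa Wb / a <= b => [H|].
  by case: (leqP a b) => h hd; [apply: H|apply/esym/H => //; lia].
move=> hd; have h : W %| b - a by rewrite dvdn_subr.
have [ba|] := posnP (b - a); first by lia.
by move=> /dvdn_leq/(_ h); lia.
Qed.

End Centres.

Section NoHamiltonian.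
Context {R : realType}.
Variables (p : \bar R) (hp : (1 <= p)%E).

Lemma touch_bound (rho : R) (N a b : nat) : rho <= N%:R -> touch p rho a b ->
  (a <= N.+1)%N && (b <= N.+1)%N.
Proof.
move=> hN h; apply/andP; split; rewrite -ltnS -[(_ < _)%N]/(_ <= _)%N.
  have : a.-1%:R <= N%:R :> R.
    apply: le_trans hN; apply: le_trans h.
    by have := lp_norm_ge1 (a.-1%:R, b.-1%:R) hp; rewrite /= (ger0_norm (ler0n _ _)).
  by rewrite ler_nat; lia.
have : b.-1%:R <= N%:R :> R.
  apply: le_trans hN; apply: le_trans h.
  by have := lp_norm_ge2 (a.-1%:R, b.-1%:R) hp; rewrite /= (ger0_norm (ler0n _ _)).
by rewrite ler_nat; lia.
Qed.

Context {d : measure_display} {T : measurableType d} (P : probability T R).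
Variables (n : nat) (X : 'I_n -> {RV P >-> plane R}).
Hypothesis hX : iid_uniform_points X.

Lemma no_hamiltonian_prob (rho r mu0 : R) (m N b : nat) :
  0 <= rho -> rho <= N%:R -> (2 * N + 3 <= m)%N -> r * m%:R <= rho -> (1 < n)%N ->
  lp_ball_area p * (rho + 4) ^+ 2 < b.+1%:R -> (b < m * m)%N -> 0 < mu0 ->
  mu0 <= n%:R / (4 * (2 * N + 3)%:R ^+ 2) * (1 - b%:R / m%:R ^+ 2) ^+ n.-1 ->
  ((1 - (mu0^-1 + (1 - b%:R / m%:R ^+ 2) ^- 2 - 1))%:E <=
   P [set w | ~ hamiltonian (geometric_graph p r (fun i => X i w))])%E.
Proof.
(* Touching cells are at most N + 1 apart in each coordinate, so centres with a common touching cell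
   are at most 2N + 2 < W apart and coincide. *)
move=> rho0 rN Wm hr n2 hb bm mu00 hmu; set W := (2 * N + 3)%N in Wm hmu.
have m0 : (0 < m)%N by move: Wm; rewrite /W; lia.
have mR : 0 < m%:R :> R by rewrite ltr0n.
have W0 : (0 < W)%N by rewrite /W addn3.
pose bg (k : 'I_m * 'I_m) := [set v | cell_adj (touch p rho) k v]%SET.
pose K := centres W m.
pose Bad := [set y : {ffun 'I_n -> 'I_m * 'I_m} | [forall k, forall i, ~~ lonely K bg k i y]]%SET.
have mE : measurable [set w | ~ hamiltonian (geometric_graph p r (fun i => X i w))].
  exact: measurableC (measurable_hamiltonian p X r).
apply: (le_trans _ (cells_prob m0 hX (B := (~: Bad)%SET) mE _)); last first.
  move=> y w yB hw /= ham.
  move: yB; rewrite !inE negb_forall => /existsP[k]; rewrite negb_forall => /existsP[i].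
  rewrite negbK => /and3P[kK /eqP yi /forallP H].
  have [j /andP[ij hd]] := hamiltonian_neighbour i ham.
  have := H j; rewrite eq_sym ij /= inE -yi => /negP; apply.
  exact: (touch_dist hp m0 hr hd (hw i) (hw j)).
rewrite lee_fin.
have cC0 : #|{: 'I_m * 'I_m}|%:R = m%:R ^+ 2 :> R by rewrite card_prod !card_ord natrM -expr2.
have cT : #|{ffun 'I_n -> 'I_m * 'I_m}|%:R = (m%:R ^+ 2) ^+ n :> R.
  by rewrite card_ffun card_ord natrX cC0.
have cpos : 0 < (m%:R ^+ 2) ^+ n :> R by rewrite !exprn_gt0.
have cC : #|(~: Bad)%SET|%:R = (m%:R ^+ 2) ^+ n - #|Bad|%:R :> R.
  by rewrite -cT -(cardsC Bad) natrD addrC addKr.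
rewrite cC mulrBl divff ?gt_eqF // lerD2l lerN2.
rewrite -!cC0 in hmu *.
have adj_close k v : v \in bg k -> ((ndist k.1 v.1 <= N.+1) && (ndist k.2 v.2 <= N.+1))%N.
  by rewrite inE => /(touch_bound rN).
have hK := card_centres W0 Wm.
apply: (no_lonely_bound n2) => //.
- move=> k _; rewrite inE /cell_adj /touch /ndist !subnn /=.
  by apply: (le_trans (lp_norm_le_sum _ hp)); rewrite /= !normr0 addr0.
- move=> k _; rewrite -ltnS -(ltr_nat R); apply: le_lt_trans hb.
  exact: lp_ball_area_ge.
- by rewrite card_prod !card_ord.
- rewrite lt0n; apply/eqP => K0; move: hK.
  by rewrite -/K K0 mul0n leqNgt expn_gt0 m0.
- move=> k l; rewrite !inE => /andP[k1 k2] /andP[l1 l2] kl.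
  rewrite -setI_eq0; apply: contraT => /set0Pn[v /setIP[/adj_close/andP[a1 a2] /adj_close/andP[b1 b2]]].
  case/negP: kl; apply/eqP; rewrite [k]surjective_pairing [l]surjective_pairing.
  congr (_, _); apply: val_inj.
    by apply: (dvdn_close k1 l1); move: a1 b1; rewrite /W /ndist; clear; lia.
  by apply: (dvdn_close k2 l2); move: a2 b2; rewrite /W /ndist; clear; lia.
apply: (le_trans hmu); apply: ler_wpM2r.
  rewrite exprn_ge0 // subr_ge0 cC0 ler_pdivrMr ?exprn_gt0 // mul1r expr2 -natrM ler_nat.
  exact: ltnW.
have W4 : 0 < W%:R :> R by rewrite ltr0n.
have h : (4 * W%:R ^+ 2)^-1 <= #|K|%:R / m%:R ^+ 2 :> R.
  rewrite ler_pdivlMr ?exprn_gt0 // mulrC ler_pdivrMr ?mulr_gt0 ?exprn_gt0 //.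
  have : (m ^ 2)%:R <= (#|K| * (2 * W) ^ 2)%:R :> R by rewrite ler_nat.
  rewrite natrX natrM natrX natrM => /le_trans; apply.
  by rewrite le_eqVlt; apply/orP; left; apply/eqP; ring.
rewrite cC0; apply: le_trans (ler_wpM2l (ler0n _ n) h) _.
by rewrite mulrA [n%:R * _]mulrC.
Qed.

End NoHamiltonian.

(** * Above the threshold *)

Lemma card_window (m L : nat) (i : 'I_m) : (#|[set j : 'I_m | (ndist i j <= L)%N]%SET| <= 2 * L + 1)%N.
Proof.
rewrite -[X in (_ <= X)%N]card_ord.
pose f (j : 'I_m) : 'I_(2 * L + 1) := insubd (Ordinal (ltac:(lia) : (0 < 2 * L + 1)%N)) (j + L - i)%N.
rewrite -(@card_in_imset _ _ f) ?max_card // => j j'; rewrite !inE /ndist => hj hj'.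
move=> /(congr1 val); rewrite !val_insubd.
have -> : (j + L - i < 2 * L + 1)%N by lia.
have -> : (j' + L - i < 2 * L + 1)%N by lia.
by move=> e; apply: val_inj => /=; lia.
Qed.

Lemma card_box (m L : nat) (c : 'I_m * 'I_m) : (#|box L c| <= (2 * L + 1) ^ 2)%N.
Proof.
have -> : box L c =
    finset.setX [set j : 'I_m | (ndist c.1 j <= L)%N]%SET [set j : 'I_m | (ndist c.2 j <= L)%N]%SET.
  by apply/setP => -[u v]; rewrite !inE.
by rewrite cardsX expnS expn1 leq_mul // card_window.
Qed.

(** The L indices at each end of the grid are laid side by side: the low ones stay, the high ones
    move to L, ..., 2L - 1. *)
Lemma card_few_open (m L : nat) : (2 * L < m)%N -> (#|[set i : 'I_m | nopen m L i == 1%N]%SET| <= 2 * L)%N.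
Proof.
move=> hm; rewrite -[X in (_ <= X)%N]card_ord.
have [->|L0] := posnP L.
  rewrite muln0 card_ord leqn0 cards_eq0; apply/eqP/setP => i; rewrite !inE /nopen /= addn0 ltn_ord //.
pose f (j : 'I_m) : 'I_(2 * L) := insubd (Ordinal (ltac:(lia) : (0 < 2 * L)%N))
  (if (j < L)%N then j : nat else (j + 2 * L - m)%N).
rewrite -(@card_in_imset _ _ f) ?max_card // => j j'; rewrite !inE /nopen => hj hj'.
have h1 := ltn_ord j; have h2 := ltn_ord j'.
move=> /(congr1 val); rewrite !val_insubd.
have -> : ((if (j < L)%N then j : nat else j + 2 * L - m) < 2 * L)%N by case: (ltnP j L); lia.
have -> : ((if (j' < L)%N then j' : nat else j' + 2 * L - m) < 2 * L)%N by case: (ltnP j' L); lia.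
by move=> e; apply: val_inj => /=; move: e; case: (ltnP j L); case: (ltnP j' L); lia.
Qed.

Section Hamiltonian.
Context {R : realType}.
Variables (p : \bar R) (hp : (1 <= p)%E).

Lemma near_mono (rho : R) (a b a' b' : nat) : (a' <= a)%N -> (b' <= b)%N ->
  near p rho a b -> near p rho a' b'.
Proof.
move=> ha hb; apply: le_trans; apply: lp_norm_mono => //=;
by rewrite !(ger0_norm (ler0n _ _)) ler_nat ltnS.
Qed.

Lemma near_small (rho : R) (a b : nat) : (a + b).+2%:R <= rho -> near p rho a b.
Proof.
apply: le_trans; apply: (le_trans (lp_norm_le_sum _ hp)) => /=.
by rewrite !(ger0_norm (ler0n _ _)) -natrD addnS addSn.
Qed.

Lemma near_bound (rho : R) (N a b : nat) : rho <= N%:R -> near p rho a b -> (a <= N)%N && (b <= N)%N.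
Proof.
move=> hN h; apply/andP; split; apply: ltnW; rewrite -(ler_nat R); apply: le_trans hN;
  apply: le_trans h.
  by have := lp_norm_ge1 (a.+1%:R, b.+1%:R) hp; rewrite /= (ger0_norm (ler0n _ _)).
by have := lp_norm_ge2 (a.+1%:R, b.+1%:R) hp; rewrite /= (ger0_norm (ler0n _ _)).
Qed.

(** The box of radius N contains all near cells; the 3 ensures that the points of one dense cell
    already form a cycle. The same number is the degree bound and the threshold for density. *)
Definition cell_degree (N : nat) : nat := ((2 * N + 1) ^ 2 + 3)%N.

Lemma dense_hamiltonian (rho r : R) (m n N L : nat) (y : {ffun 'I_n -> 'I_m * 'I_m})
    (x : 'I_n -> plane R) :
  4 < rho -> rho <= N%:R -> (8 * near_count p rho N < L)%N -> (2 * L < m)%N -> rho <= r * m%:R ->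
  (forall c, (#|box L c :\: dense_cells (cell_degree N) y| <
              near_count p rho N * nopen m L c.1 * nopen m L c.2)%N) ->
  (forall i, cell_square (y i) (x i)) -> hamiltonian (geometric_graph p r x).
Proof.
move=> r4 rN hL hm hr few hx; have m0 : (0 < m)%N by lia.
have n10 : near p rho 1 0 by apply: near_small; lra.
have n01 : near p rho 0 1 by apply: near_small; lra.
have H1 := dense_neighbour (@near_mono rho) n10 n01 (leqnn _) hL hm few.
have H2 := dense_linked (@near_mono rho) n10 n01 (leqnn _) hL hm few.
apply: (@blowup_hamiltonian _ _ y _ (cell_adj (near p rho)) (cell_degree N)
  (dense_cells (cell_degree N) y)) => //.
- move=> u v uv huv; rewrite /geometric_graph uv /=.
  exact: (near_dist hp m0 hr huv (hx u) (hx v)).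
- exact: (cell_adj_refl (@near_mono rho) n10).
- exact: cell_adj_sym.
- move=> c; apply: (@leq_trans #|box N c|).
    apply: subset_leq_card; apply/fintype.subsetP => d; rewrite !inE.
    exact: near_bound.
  by apply: leq_trans (card_box _ _) _; rewrite /cell_degree leq_addr.
- by rewrite /cell_degree addn3.
- by move=> c; rewrite inE.
- have [d hd _] := H1 (Ordinal m0, Ordinal m0); by apply/set0Pn; exists d.
Qed.

(** At most m^2 cells contribute E^4, at most 4Lm near the sides contribute E^2, and at most 4L^2
    near the corners contribute E. *)
Lemma sum_open_bound (m L : nat) (E : R) : (2 * L < m)%N -> 0 <= E <= 1 ->
  \sum_(c : 'I_m * 'I_m) E ^+ (nopen m L c.1 * nopen m L c.2) <=
    (m%:R * E ^+ 2) ^+ 2 + 4 * L%:R * (m%:R * E ^+ 2) + 4 * L%:R ^+ 2 * E.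
Proof.
move=> hm /andP[E0 E1].
pose s (i : 'I_m) : R := (nopen m L i == 1%N)%:R.
have s0 i : 0 <= s i by apply: ler0n.
have cs : \sum_i s i <= 2 * L%:R.
  rewrite -[2]/(2%:R) -natrM -natr_sum ler_nat.
  apply: leq_trans (card_few_open hm); rewrite -sum1dep_card [leqRHS]big_mkcond.
  by apply: leq_sum => i _; case: eqP.
have cs0 : 0 <= \sum_i s i by apply: sumr_ge0.
apply: (@le_trans _ _ (\sum_(c : 'I_m * 'I_m)
  (E ^+ 4 + E ^+ 2 * s c.1 + E ^+ 2 * s c.2 + E * (s c.1 * s c.2)))).
  apply: ler_sum => -[i j] _ /=; rewrite /s.
  have o12 (k : 'I_m) : nopen m L k = 1%N \/ nopen m L k = 2%N.
    by rewrite /nopen; have := ltn_ord k; case: leqP; case: ltnP => /=; lia.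
  have E2 : 0 <= E ^+ 2 by apply: exprn_ge0.
  have E4 : 0 <= E ^+ 4 by apply: exprn_ge0.
  by case: (o12 i) => ->; case: (o12 j) => -> /=; rewrite ?muln1 ?mul1n ?expr1; lra.
have e m' (F G : 'I_m' -> R) : \sum_(c : 'I_m' * 'I_m') F c.1 * G c.2 = (\sum_i F i) * (\sum_i G i).
  by rewrite mulr_suml -(pair_big predT predT (fun i j => F i * G j)) /=; apply: eq_bigr => i _; rewrite mulr_sumr.
have e1 : \sum_(c : 'I_m * 'I_m) s c.1 = m%:R * \sum_i s i.
  have := e m s (fun=> 1); rewrite sumr_const card_ord mulrC => <-.
  by apply: eq_bigr => c _; rewrite mulr1.
have e2 : \sum_(c : 'I_m * 'I_m) s c.2 = m%:R * \sum_i s i.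
  have := e m (fun=> 1) s; rewrite sumr_const card_ord => <-.
  by apply: eq_bigr => c _; rewrite mul1r.
rewrite !big_split /= -!mulr_sumr e e1 e2 sumr_const card_prod !card_ord -[_ *+ (m * m)]mulr_natl natrM.
move: cs cs0; move: (\sum_i s i) => S cs cs0.
have h1 : m%:R * E ^+ 2 * S <= m%:R * E ^+ 2 * (2 * L%:R).
  by apply: ler_wpM2l => //; rewrite mulr_ge0 // exprn_ge0.
have h2 : E * (S * S) <= E * (2 * L%:R * (2 * L%:R)).
  by apply: ler_wpM2l => //; apply: ler_pM.
have -> : E * (E * (E * (m%:R * m%:R * E))) = (m%:R * E ^+ 2) ^+ 2 by ring.
have -> : E ^+ 2 * (m%:R * S) = m%:R * E ^+ 2 * S by ring.
have -> : 4 * L%:R ^+ 2 * E = E * (2 * L%:R * (2 * L%:R)) by ring.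
have -> : 4 * L%:R * (m%:R * E ^+ 2) = 2 * (m%:R * E ^+ 2 * (2 * L%:R)) by ring.
by lra.
Qed.

Context {d : measure_display} {T : measurableType d} (P : probability T R).
Variables (n : nat) (X : 'I_n -> {RV P >-> plane R}).
Hypothesis hX : iid_uniform_points X.

(** [E] bounds the cost of [q] sparse cells, that is, of one quadrant, by 1 - z <= exp(-z); a window
    with several open quadrants has the corresponding power of [E]. *)
Lemma hamiltonian_prob (rho r th E : R) (m N L : nat) :
  4 < rho -> rho <= N%:R -> (8 * near_count p rho N < L)%N -> (2 * L < m)%N -> rho <= r * m%:R ->
  0 < th <= 1 -> expR (- ((1 - th) * (near_count p rho N)%:R * n%:R / m%:R ^+ 2)) <= E <= 1 ->
  ((1 - 2 ^+ ((2 * L + 1) ^ 2) * th ^- (4 * near_count p rho N * cell_degree N) *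
     ((m%:R * E ^+ 2) ^+ 2 + 4 * L%:R * (m%:R * E ^+ 2) + 4 * L%:R ^+ 2 * E))%:E <=
   P [set w | hamiltonian (geometric_graph p r (fun i => X i w))])%E.
Proof.
move=> r4 rN hL hm hr hth /andP[hE E1]; set q := near_count p rho N in hL hE *.
have m0 : (0 < m)%N by lia.
have mR : 0 < m%:R :> R by rewrite ltr0n.
have E0 : 0 <= E by apply: le_trans hE; apply: expR_ge0.
set M := cell_degree N.
pose k (c : 'I_m * 'I_m) := (q * nopen m L c.1 * nopen m L c.2)%N.
have k4 c : (k c <= 4 * q)%N.
  apply: leq_trans (leq_mul (leq_mul (leqnn q) (nopen_le2 m L c.1)) (nopen_le2 m L c.2)) _.
  by rewrite -mulnA mulnC.
have q4 : (4 * q <= m * m)%N by move: hL hm; clear; nia.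
pose Bad := [set y : {ffun 'I_n -> 'I_m * 'I_m} | [exists c, (k c <= #|box L c :\: dense_cells M y|)%N]]%SET.
apply: (le_trans _ (cells_prob m0 hX (B := (~: Bad)%SET) (measurable_hamiltonian p X r) _)); last first.
  move=> y w yB hw; apply: (dense_hamiltonian r4 rN hL hm hr _ hw) => c.
  move: yB; rewrite !inE negb_exists => /forallP/(_ c).
  by rewrite -ltnNge.
rewrite lee_fin.
have cT : #|{ffun 'I_n -> 'I_m * 'I_m}|%:R = (m%:R ^+ 2) ^+ n :> R.
  by rewrite card_ffun card_prod !card_ord natrX natrM -expr2.
have cpos : 0 < (m%:R ^+ 2) ^+ n :> R by rewrite !exprn_gt0.
have cC : #|(~: Bad)%SET|%:R = (m%:R ^+ 2) ^+ n - #|Bad|%:R :> R.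
  by rewrite -cT -(cardsC Bad) natrD addrC addKr.
rewrite cC mulrBl divff ?gt_eqF // lerD2l lerN2 ler_pdivrMr //.
apply: (le_trans (@card_many_sparse R n M _ (box L) k _ (4 * q)%N th hth
  (card_box (m := m) L) _ _)).
- exact: k4.
- by rewrite card_prod !card_ord.
rewrite -!mulrA; apply: ler_wpM2l; first by rewrite exprn_ge0.
apply: ler_wpM2l; first by rewrite invr_ge0 exprn_ge0 // ltW //; case/andP: hth.
apply: (@le_trans _ _ (\sum_(c : 'I_m * 'I_m)
  (E ^+ (nopen m L c.1 * nopen m L c.2) * (m%:R ^+ 2) ^+ n))); last first.
  rewrite -mulr_suml; apply: ler_wpM2r; first exact: ltW.
  apply: le_trans (sum_open_bound hm _) _; first by rewrite E0.
  by rewrite le_eqVlt; apply/orP; left; apply/eqP; ring.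
apply: ler_sum => c _; rewrite card_prod !card_ord natrM -expr2.
have -> : m%:R ^+ 2 - (1 - th) * (k c)%:R = (1 - (1 - th) * (k c)%:R / m%:R ^+ 2) * m%:R ^+ 2.
  by rewrite [RHS]mulrBl mul1r divfK // gt_eqF // exprn_gt0.
rewrite exprMn; apply: ler_wpM2r; first exact: ltW.
have base0 : 0 <= 1 - (1 - th) * (k c)%:R / m%:R ^+ 2.
  rewrite subr_ge0 ler_pdivrMr ?exprn_gt0 // mul1r; apply: (@le_trans _ _ (k c)%:R).
    by apply: ler_piMl => //; case/andP: hth; lra.
  by rewrite expr2 -natrM ler_nat (leq_trans (k4 c)).
apply: (@le_trans _ _ (expR (- ((1 - th) * (k c)%:R / m%:R ^+ 2)) ^+ n)).
  apply: lerXn2r; rewrite ?nnegrE ?expR_ge0 //.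
  by have := expR_ge1Dx (- ((1 - th) * (k c)%:R / m%:R ^+ 2)).
rewrite -expRM_natl.
have -> : n%:R * - ((1 - th) * (k c)%:R / m%:R ^+ 2) =
    (nopen m L c.1 * nopen m L c.2)%:R * - ((1 - th) * q%:R * n%:R / m%:R ^+ 2).
  by rewrite /k -mulnA natrM; ring.
by rewrite expRM_natl; apply: lerXn2r; rewrite ?nnegrE ?expR_ge0.
Qed.

End Hamiltonian.

(** * Asymptotics *)

Section Asymptotics.
Context {R : realType}.

Lemma near_natr_ge (A : R) : \forall n \near \oo, A <= n%:R.
Proof.
exists (Num.truncn A).+1 => // n /= hn; apply: ltW.
by apply: lt_le_trans (truncnS_gt A) _; rewrite ler_nat.
Qed.

Lemma near_ln_ge (A : R) : \forall n \near \oo, A <= ln n%:R.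
Proof.
apply: filterS (near_natr_ge (expR A)) => n hn.
have n0 : 0 < n%:R :> R by apply: lt_le_trans hn; apply: expR_gt0.
by rewrite -[A]expRK ler_ln ?posrE ?expR_gt0.
Qed.

(** From exp(x / 2) >= 1 + x / 2 with x = ln n one gets n >= (ln n)^2 / 4. *)
Lemma near_ln_le (e : R) : 0 < e -> \forall n \near \oo, ln n%:R <= e * n%:R.
Proof.
move=> e0; apply: filterS2 (near_natr_ge 1) (near_ln_ge (4 / e)) => n n1 hln.
have n0 : 0 < n%:R :> R by lra.
have l0 : 0 <= ln n%:R :> R by apply: le_trans hln; rewrite divr_ge0 // ltW.
have h : (ln n%:R) ^+ 2 / 4 <= n%:R :> R.
  rewrite -[leRHS]lnK ?posrE //.
  have -> : expR (ln n%:R) = expR (ln n%:R / 2) ^+ 2 :> R by rewrite -expRM_natl; congr expR; field.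
  have := expR_ge1Dx (ln n%:R / 2 : R) => h.
  apply: (@le_trans _ _ ((ln n%:R / 2) ^+ 2)); first by rewrite le_eqVlt; apply/orP; left; apply/eqP; field.
  by apply: lerXn2r; rewrite ?nnegrE ?expR_ge0 //; [rewrite divr_ge0|lra].
apply: (@le_trans _ _ (e * ((ln n%:R) ^+ 2 / 4))); last by rewrite ler_pM2l.
have : 1 <= e * (ln n%:R / 4) by rewrite mulrA ler_pdivlMr // mul1r mulrC -ler_pdivrMr.
by move=> h1; rewrite expr2; nra.
Qed.

Lemma aas_lower_bound (d : nat -> measure_display) (T : forall n, measurableType (d n))
    (P : forall n, probability (T n) R) (E : forall n, set (T n)) :
  (forall n, measurable (E n)) ->
  (forall e : R, 0 < e -> \forall n \near \oo, ((1 - e)%:E <= P n (E n))%E) -> aas P E.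
Proof.
move=> mE H; rewrite /aas.
have fin n : P n (E n) = (fine (P n (E n)))%:E.
  by rewrite fineK // fin_num_measure.
rewrite (_ : (fun n => P n (E n)) = EFin \o (fun n => fine (P n (E n)))); last exact/funext.
apply: cvg_EFin; first exact: nearW.
apply/cvgrPdist_le => e e0; apply: filterS (H e e0) => n hn.
have h1 : fine (P n (E n)) <= 1 by rewrite -lee_fin -fin probability_le1.
have h2 : 1 - e <= fine (P n (E n)) by rewrite -lee_fin -fin.
by rewrite /= ler_norml; apply/andP; split; lra.
Qed.

Lemma rgg_radius_sqr (a : R) (n : nat) : 0 < a -> 1 <= n%:R :> R ->
  rgg_radius a n ^+ 2 * (a * n%:R) = ln n%:R.
Proof.
move=> a0 n1; have an : 0 < a * n%:R by rewrite mulr_gt0 //; lra.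
rewrite sqr_sqrtr ?divfK ?gt_eqF // divr_ge0 ?ln_ge0 // ltW //.
Qed.

Lemma near_radius (a c : R) : 0 < a -> 0 < c ->
  \forall n \near \oo, 0 < rgg_radius a n <= c.
Proof.
move=> a0 c0.
have h0 : 0 < c ^+ 2 * a by rewrite mulr_gt0 // exprn_gt0.
apply: filterS3 (near_natr_ge 1) (near_ln_ge 1) (near_ln_le h0) => n n1 l1 l2.
have an : 0 < a * n%:R by rewrite mulr_gt0 //; lra.
rewrite sqrtr_gt0 divr_gt0 //=; last lra.
rewrite -(ger0_norm (ltW c0)) -sqrtr_sqr ler_wsqrtr // ler_pdivrMr //.
by rewrite mulrA.
Qed.

End Asymptotics.

(** * Choice of the parameters on the two sides of the threshold *)

Section Thresholds.
Context {R : realType}.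
Variables (p : \bar R) (hp : (1 <= p)%E).
Variables (d : nat -> measure_display) (T : forall n, measurableType (d n)).
Variables (P : forall n, probability (T n) R) (X : forall n, 'I_n -> {RV (P n) >-> plane R}).
Hypothesis hX : forall n, iid_uniform_points (@X n).
Notation alpha := (lp_ball_area p).

Lemma supercritical_hamiltonian (a : R) : 0 < a -> a < alpha ->
  aas P (fun n => [set w | hamiltonian (geometric_graph p (rgg_radius a n) (fun i => @X n i w))]).
Proof.
move=> a0 aalpha; apply: aas_lower_bound => [n|e e0]; first exact: measurable_hamiltonian.
have alpha0 := lp_ball_area_gt0 hp.
have D0 : 0 < 7 * (alpha + a) by lra.
have [t [t0 t1 et]] : exists t, [/\ 0 < t, t < 1 & 7 * t * (alpha + a) = alpha - a].
  exists ((alpha - a) / (7 * (alpha + a))); split; last by field; lra.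
    by rewrite divr_gt0 // subr_gt0.
  by rewrite ltr_pdivrMr //; lra.
(* On the right, (1 - t)^2 is lost by paving the disk and 1 - t by the weight [th], taken to be [t];
   on the left, (1 + t)^2 by rounding [m], and 1 + t is the room left in [E]. The 7 in the choice of
   [t] comes from (1 + t)^3 <= 1 + 7t. *)
have gap : a * (1 + t) ^+ 3 <= alpha * (1 - t) ^+ 3.
  have h1 : (1 + t) ^+ 3 <= 1 + 7 * t by rewrite !exprS expr0; nra.
  have h2 : 1 - 3 * t <= (1 - t) ^+ 3 by rewrite !exprS expr0; nra.
  apply: (@le_trans _ _ (a * (1 + 7 * t))); first by rewrite ler_pM2l.
  apply: (@le_trans _ _ (alpha * (1 - 3 * t))); last by rewrite ler_pM2l.
  have ta : 0 <= t * alpha by rewrite mulr_ge0 // ltW.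
  by move: et ta; lra.
have [rho [r4 er]] : exists rho, 4 < rho /\ rho - 4 = rho * (1 - t).
  exists (4 / t); split; last by field; lra.
  by rewrite ltr_pdivlMr //; lra.
have rho0 : 0 < rho by lra.
pose N := (Num.truncn rho).+1.
have rN : rho <= N%:R by apply: ltW; exact: truncnS_gt.
pose q := near_count p rho N.
have hq : alpha * (rho * (1 - t)) ^+ 2 <= 4 * q%:R by rewrite -er; apply: lp_ball_area_le.
pose L := (8 * q).+1.
pose K := 2 ^+ ((2 * L + 1) ^ 2) * t ^- (4 * q * cell_degree N) * (1 + 4 * L%:R + 4 * L%:R ^+ 2) : R.
have L0 : 0 <= L%:R :> R by [].
have K0 : 0 < K.
  have pos (z : R) : 0 <= z -> 0 < 1 + 4 * z + 4 * z ^+ 2 by move=> z0; have := sqr_ge0 z; lra.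
  by rewrite !mulr_gt0 ?invr_gt0 ?exprn_gt0 // pos.
have c0 : 0 < Num.min (t * rho) (rho / (2 * L.+1)%:R).
  by rewrite lt_min mulr_gt0 ?divr_gt0 ?ltr0n //; lra.
near=> n.
have n1 : 1 <= n%:R :> R by near: n; apply: near_natr_ge.
have hln : 4 * rho ^+ 2 * a + 1 <= ln n%:R by near: n; apply: near_ln_ge.
have hlnK : - (4 / t) * ln (e / K) <= ln n%:R by near: n; apply: near_ln_ge.
have /andP[rad0] : 0 < rgg_radius a n <= Num.min (t * rho) (rho / (2 * L.+1)%:R).
  by near: n; apply: near_radius.
have rsq := rgg_radius_sqr a0 n1.
set r := rgg_radius a n in rad0 rsq *.
rewrite le_min => /andP[hr1 hr2].
(* Rounded up, so that near cells only contain points within distance r. *)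
pose m := (Num.truncn (rho / r)).+1.
have m1 : rho / r < m%:R by exact: truncnS_gt.
have m2 : m%:R <= rho / r + 1.
  by rewrite -natr1 lerD2r truncn_le // divr_ge0 ?ltW //; lra.
have rm1 : rho <= r * m%:R by rewrite mulrC -ler_pdivrMr // ltW.
have rm2 : r * m%:R <= rho * (1 + t).
  apply: (@le_trans _ _ (r * (rho / r + 1))); first by rewrite ler_pM2l.
  by rewrite mulrDr mulrCA divff ?gt_eqF //; lra.
have hm : (2 * L < m)%N.
  rewrite -(ltr_nat R); apply: le_lt_trans m1.
  rewrite ler_pdivlMr //; apply: (@le_trans _ _ ((2 * L.+1)%:R * r)).
    by rewrite ler_pM2r // ler_nat leq_mul.
  by rewrite mulrC -ler_pdivlMr // ltr0n.
have mR : 0 < m%:R :> R by rewrite ltr0n.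
have n0 : 0 < n%:R :> R by lra.
have an0 : 0 < a * n%:R by rewrite mulr_gt0.
have ln0 : 0 < ln n%:R :> R.
  by apply: lt_le_trans hln; rewrite ltr_wpDl // !mulr_ge0 // ltW.
have mn : m%:R ^+ 2 <= n%:R :> R.
  rewrite -(ler_pM2r ln0) -[in leLHS]rsq.
  have -> : m%:R ^+ 2 * (r ^+ 2 * (a * n%:R)) = (r * m%:R) ^+ 2 * (a * n%:R) by ring.
  apply: (@le_trans _ _ ((rho * 2) ^+ 2 * (a * n%:R))).
    rewrite ler_pM2r // lerXn2r ?nnegrE ?mulr_ge0 ?(ltW rad0) ?(ltW rho0) //.
    by apply: (le_trans rm2); rewrite ler_pM2l //; lra.
  have -> : (rho * 2) ^+ 2 * (a * n%:R) = n%:R * (4 * rho ^+ 2 * a) by ring.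
  by rewrite ler_pM2l //; lra.
(* E = n^(-(1+t)/4) and eta = n^(-t/4). As m^2 <= n, m E^2 is at most eta^2, and all terms of
   [sum_open_bound] are of order eta; [K] collects the constants. *)
pose E := expR (- ((1 + t) / 4 * ln n%:R)) : R.
pose eta := expR (- (t / 4 * ln n%:R)) : R.
have E0 : 0 < E := expR_gt0 _.
have eta0 : 0 < eta := expR_gt0 _.
have eta1 : eta <= 1.
  by rewrite -expR0 ler_expR oppr_le0 mulr_ge0 ?divr_ge0 ?ltW.
have Eeta : E <= eta.
  by rewrite ler_expR lerN2 ler_pM2r // ler_pM2r ?invr_gt0 //; lra.
have hE : expR (- ((1 - t) * q%:R * n%:R / m%:R ^+ 2)) <= E.
  rewrite ler_expR lerN2 ler_pdivlMr ?exprn_gt0 // -rsq.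
  have -> : (1 + t) / 4 * (r ^+ 2 * (a * n%:R)) * m%:R ^+ 2 =
      (1 + t) / 4 * (a * n%:R) * (r * m%:R) ^+ 2 by ring.
  apply: (@le_trans _ _ ((1 + t) / 4 * (a * n%:R) * (rho * (1 + t)) ^+ 2)).
    rewrite ler_pM2l ?mulr_gt0 ?invr_gt0 //; last lra.
    rewrite lerXn2r ?nnegrE ?mulr_ge0 ?(ltW rad0) ?(ltW rho0) //; lra.
  have -> : (1 + t) / 4 * (a * n%:R) * (rho * (1 + t)) ^+ 2 =
      n%:R / 4 * rho ^+ 2 * (a * (1 + t) ^+ 3) by field.
  apply: (@le_trans _ _ (n%:R / 4 * rho ^+ 2 * (alpha * (1 - t) ^+ 3))).
    by rewrite ler_pM2l // !mulr_gt0 // exprn_gt0.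
  have -> : n%:R / 4 * rho ^+ 2 * (alpha * (1 - t) ^+ 3) =
      (n%:R / 4 * (1 - t)) * (alpha * (rho * (1 - t)) ^+ 2) by field.
  have -> : (1 - t) * q%:R * n%:R = (n%:R / 4 * (1 - t)) * (4 * q%:R) by field.
  by rewrite ler_pM2l // !mulr_gt0 // subr_gt0.
have mE : m%:R * E ^+ 2 <= eta ^+ 2.
  have m0 : 0 <= m%:R * E ^+ 2 by rewrite mulr_ge0 // exprn_ge0 // ltW.
  rewrite -(@ler_pXn2r _ 2) ?nnegrE ?exprn_ge0 ?(ltW eta0) //.
  apply: (@le_trans _ _ (expR (ln n%:R) * E ^+ 4)).
    rewrite lnK ?posrE // exprMn -exprM ler_pM2r // exprn_gt0 //.
  rewrite /E /eta -exprM -!expRM_natl -expRD ler_expR le_eqVlt.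
  by apply/orP; left; apply/eqP; field.
have Keta : K * eta <= e.
  rewrite mulrC -ler_pdivlMr // -[leRHS]lnK ?posrE ?divr_gt0 // ler_expR.
  have -> : ln (e / K) = - (t / 4 * (- (4 / t) * ln (e / K))) by field; lra.
  by rewrite lerN2 ler_pM2l // divr_gt0.
apply: le_trans (hamiltonian_prob hp (hX n) (th := t) (E := E) r4 rN (leqnn _) hm rm1 _ _).
- rewrite lee_fin lerD2l lerN2; apply: le_trans Keta.
  rewrite /K -[leRHS]mulrA; apply: ler_wpM2l.
    by rewrite mulr_ge0 ?invr_ge0 ?exprn_ge0 // ltW.
  have z0 : 0 <= m%:R * E ^+ 2 by rewrite mulr_ge0 // exprn_ge0 // ltW.
  have e2 : eta ^+ 2 <= eta by rewrite expr2 ler_piMl // ltW.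
  have z1 : m%:R * E ^+ 2 <= eta by apply: le_trans e2.
  have z2 : (m%:R * E ^+ 2) ^+ 2 <= eta.
    rewrite expr2; apply: le_trans z1; apply: ler_piMl => //; lra.
  have -> : (1 + 4 * L%:R + 4 * L%:R ^+ 2) * eta =
      eta + 4 * L%:R * eta + 4 * L%:R ^+ 2 * eta :> R by ring.
  apply: lerD; first apply: lerD => //.
    by apply: ler_wpM2l => //; rewrite mulr_ge0.
  by apply: ler_wpM2l => //; rewrite mulr_ge0 // exprn_ge0.
- by rewrite t0 ltW.
- by rewrite hE (le_trans Eeta).
Unshelve. all: by end_near.
Qed.

Lemma subcritical_not_hamiltonian (a : R) : alpha < a ->
  aas P (fun n => [set w | ~ hamiltonian (geometric_graph p (rgg_radius a n) (fun i => @X n i w))]).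
Proof.
move=> aalpha; apply: aas_lower_bound => [n|e e0].
  exact: measurableC (measurable_hamiltonian _ _ _).
have alpha0 := lp_ball_area_gt0 hp.
have a0 : 0 < a by lra.
have D0 : 0 < 4 * (a + alpha) by lra.
have [t [t0 t1 et]] : exists t, [/\ 0 < t, t < 1 / 4 & 4 * t * (a + alpha) = a - alpha].
  exists ((a - alpha) / (4 * (a + alpha))); split; last by field; lra.
    by rewrite divr_gt0 // subr_gt0.
  by rewrite ltr_pdivrMr //; lra.
(* (1 + t)^2 is lost by paving. On the right, (1 - t)^2 comes from rounding [m], one factor from
   comparing 1 - x with an exponential, and one lets the expected number of lonely points grow like
   n^t. *)
have gap : alpha * (1 + t) ^+ 2 <= a * (1 - t) ^+ 4.
  have h1 : (1 + t) ^+ 2 <= 1 + 3 * t by rewrite expr2; nra.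
  have h2 : 1 - 4 * t <= (1 - t) ^+ 4 by rewrite !exprS expr0; nra.
  apply: (@le_trans _ _ (alpha * (1 + 3 * t))); first by rewrite ler_pM2l.
  apply: (@le_trans _ _ (a * (1 - 4 * t))); last by rewrite ler_pM2l.
  have ta : 0 <= t * alpha by rewrite mulr_ge0 // ltW.
  by move: et ta; lra.
have [rho [rho0 er]] : exists rho, 0 < rho /\ rho + 4 = rho * (1 + t).
  exists (4 / t); split; last by field; lra.
  by rewrite divr_gt0.
pose N := (Num.truncn rho).+1.
have rN : rho <= N%:R by apply: ltW; exact: truncnS_gt.
have ab0 : 0 <= alpha * (rho + 4) ^+ 2 by rewrite mulr_ge0 ?exprn_ge0 ?ltW //; lra.
pose b := Num.truncn (alpha * (rho + 4) ^+ 2).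
have hb1 : alpha * (rho + 4) ^+ 2 < b.+1%:R by exact: truncnS_gt.
have hb2 : b%:R <= alpha * (rho + 4) ^+ 2 by rewrite truncn_le.
pose W := (2 * N + 3)%N.
have WR : 0 < W%:R :> R by rewrite ltr0n /W addn3.
(* The three bounds give W <= m, x <= t and 16 x <= e for the fraction x = b / m^2 of the cells
   covered by a disk. *)
pose m_min : R := Num.max W%:R (Num.max (b%:R / t + 1) (16 * b%:R / e + 1)).
have mm0 : 0 < m_min by rewrite lt_max WR.
have c0 : 0 < Num.min (t * rho) (rho / (m_min + 1)).
  by rewrite lt_min mulr_gt0 ?divr_gt0 //; lra.
near=> n.
have n1 : 2%:R <= n%:R :> R by near: n; apply: near_natr_ge.
have hln : 1 <= ln n%:R :> R by near: n; apply: near_ln_ge.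
have hlne : - t^-1 * ln (e / (8 * W%:R ^+ 2)) <= ln n%:R by near: n; apply: near_ln_ge.
have /andP[rad0] : 0 < rgg_radius a n <= Num.min (t * rho) (rho / (m_min + 1)).
  by near: n; apply: near_radius.
have n1' : 1 <= n%:R :> R by lra.
have rsq := rgg_radius_sqr a0 n1'.
have nn2 : (1 < n)%N by rewrite -(ler_nat R).
have n0 : 0 < n%:R :> R by lra.
set r := rgg_radius a n in rad0 rsq *.
rewrite le_min => /andP[hr1 hr2].
(* Rounded down, so that points within distance r lie in touching cells. *)
pose m := Num.truncn (rho / r).
have rr0 : 0 <= rho / r by rewrite divr_ge0 ?ltW.
have m1 : rho / r < m%:R + 1 by rewrite natr1; exact: truncnS_gt.
have m2 : m%:R <= rho / r by rewrite truncn_le.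
have rm1 : r * m%:R <= rho by rewrite mulrC -ler_pdivlMr.
have rm2 : rho * (1 - t) <= r * m%:R.
  have : rho <= r * (m%:R + 1) by rewrite mulrC -ler_pdivrMr // ltW.
  by rewrite mulrDr mulr1; lra.
have hmm : m_min <= m%:R.
  have : m_min + 1 <= rho / r.
    by rewrite ler_pdivlMr // mulrC -ler_pdivlMr //; lra.
  by lra.
have mR : 0 < m%:R :> R by lra.
move: (hmm); rewrite !ge_max => /and3P[hW hbt hbe].
have hWm : (W <= m)%N by rewrite -(ler_nat R).
have mm1 : 1 <= m%:R :> R by rewrite ler1n -(ltr0n R).
have mle : m%:R <= m%:R ^+ 2 :> R by rewrite expr2 ler_peMl // ltW.
pose x : R := b%:R / m%:R ^+ 2.
have x0 : 0 <= x by rewrite divr_ge0 // exprn_ge0 // ltW.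
have xt : x <= t.
  rewrite ler_pdivrMr ?exprn_gt0 // [leRHS]mulrC -ler_pdivrMr //; lra.
have xe : 16 * x <= e.
  rewrite /x mulrA ler_pdivrMr ?exprn_gt0 // [leRHS]mulrC -ler_pdivrMr //; lra.
have bm : (b < m * m)%N.
  rewrite -(ltr_nat R) natrM -expr2 -[ltRHS]mul1r -ltr_pdivrMr ?exprn_gt0 //.
  by apply: le_lt_trans xt _; lra.
have U0 : 0 < 1 - x by lra.
(* For x <= t one has (1 - x)(1 + x / (1 - t)) >= 1. *)
have Uexp : expR (- (x / (1 - t))) <= 1 - x.
  rewrite -[leRHS]invrK expRN lef_pV2 ?posrE ?expR_gt0 ?invr_gt0 //.
  apply: (@le_trans _ _ (1 + x / (1 - t))); last exact: expR_ge1Dx.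
  have h : x <= x / (1 - t) * (1 - x).
    by rewrite mulrAC ler_pdivlMr; [apply: ler_wpM2l => //|]; lra.
  by rewrite -[leLHS]mul1r ler_pdivrMr // mulrDl mul1r; lra.
pose mu0 : R := n%:R / (4 * W%:R ^+ 2) * expR (- ((1 - t) * ln n%:R)).
have W2 : 0 < 4 * W%:R ^+ 2 :> R by rewrite mulr_gt0 // exprn_gt0.
have mu00 : 0 < mu0 by rewrite mulr_gt0 ?expR_gt0 // divr_gt0.
have hmu : mu0 <= n%:R / (4 * (2 * N + 3)%:R ^+ 2) * (1 - b%:R / m%:R ^+ 2) ^+ n.-1.
  rewrite -/W -/x; apply: ler_wpM2l; first by rewrite divr_ge0 // ltW.
  apply: (@le_trans _ _ ((1 - x) ^+ n)); last first.
    by apply: ler_wiXn2l; [exact: ltW|lra|exact: leq_pred].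
  apply: (@le_trans _ _ (expR (- (x / (1 - t))) ^+ n)); last first.
    by rewrite lerXn2r ?nnegrE ?expR_ge0 // ltW.
  rewrite -expRM_natl ler_expR mulrN lerN2 mulrA ler_pdivrMr; last lra.
  rewrite mulrA ler_pdivrMr ?exprn_gt0 // -rsq.
  apply: (@le_trans _ _ (n%:R * (alpha * (rho + 4) ^+ 2))); first by rewrite ler_pM2l.
  have -> : n%:R * (alpha * (rho + 4) ^+ 2) = n%:R * rho ^+ 2 * (alpha * (1 + t) ^+ 2).
    by rewrite er; ring.
  apply: (@le_trans _ _ (n%:R * rho ^+ 2 * (a * (1 - t) ^+ 4))).
    by rewrite ler_pM2l // mulr_gt0 // exprn_gt0.
  have -> : n%:R * rho ^+ 2 * (a * (1 - t) ^+ 4) =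
    (1 - t) ^+ 2 * (a * n%:R) * (rho * (1 - t)) ^+ 2 by ring.
  have -> : (1 - t) * (r ^+ 2 * (a * n%:R)) * (1 - t) * m%:R ^+ 2 =
    (1 - t) ^+ 2 * (a * n%:R) * (r * m%:R) ^+ 2 by ring.
  have t1' : 0 < 1 - t by lra.
  rewrite ler_pM2l; last by rewrite !mulr_gt0 // exprn_gt0.
  by apply: lerXn2r; rewrite ?nnegrE ?mulr_ge0 // ltW.
have hinv : mu0^-1 <= e / 2.
  have -> : mu0^-1 = 4 * W%:R ^+ 2 * expR (- (t * ln n%:R)).
    rewrite /mu0 -{1}(lnK (x := n%:R)) ?posrE // mulrAC -expRD.
    have -> : ln n%:R - (1 - t) * ln n%:R = t * ln n%:R :> R by ring.
    by rewrite invf_div expRN.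
  rewrite mulrC -ler_pdivlMr //.
  have -> : e / 2 / (4 * W%:R ^+ 2) = e / (8 * W%:R ^+ 2) by field; rewrite gt_eqF.
  rewrite -[leRHS]lnK ?posrE ?divr_gt0 ?mulr_gt0 ?exprn_gt0 // ler_expR.
  have -> : ln (e / (8 * W%:R ^+ 2)) = - (t * (- t^-1 * ln (e / (8 * W%:R ^+ 2)))).
    by field; rewrite gt_eqF.
  by rewrite lerN2 ler_pM2l.
have hU : (1 - x) ^- 2 - 1 <= e / 2.
  have h : (1 - x) ^- 2 <= 1 + 8 * x.
    rewrite -[leLHS]mul1r ler_pdivrMr ?exprn_gt0 //.
    have x4 : x <= 1 / 4 by lra.
    rewrite expr2; move: x0 x4; move: (x) => z z0 z4; nra.
  by lra.
apply: le_trans (no_hamiltonian_prob hp (hX n) (ltW rho0) rN hWm rm1 nn2 hb1 bm mu00 hmu).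
by rewrite lee_fin -/x; lra.
Unshelve. all: by end_near.
Qed.

End Thresholds.

(** * From area constants to multiples of the radius *)

Section SharpThreshold.
Context {R : realType}.

(** Multiplying the radius by [c] divides the area constant by c^2, which turns the multiplicative
    window of [sharp_threshold] into constants above and below alpha. *)
Lemma rgg_radius_scale (a c : R) (n : nat) : 0 < c ->
  rgg_radius (a / c ^+ 2) n = c * rgg_radius a n.
Proof.
move=> c0; rewrite /rgg_radius.
have -> : ln n%:R / (a / c ^+ 2 * n%:R) = c ^+ 2 * (ln n%:R / (a * n%:R)).
  by rewrite mulrAC invf_div mulrCA.
by rewrite sqrtrM ?sqr_ge0 // sqrtr_sqr ger0_norm // ltW.
Qed.

Lemma aas_mono (d : nat -> measure_display) (T : forall n, measurableType (d n))
    (P : forall n, probability (T n) R) (E F : forall n, set (T n)) :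
  (forall n, measurable (E n)) -> (forall n, measurable (F n)) ->
  (\forall n \near \oo, E n `<=` F n) -> aas P E -> aas P F.
Proof.
move=> mE mF EF hE; apply: (squeeze_cvge _ hE (cvg_cst 1%E)).
apply: filterS EF => n hn; rewrite probability_le1 // andbT.
by apply: le_measure; rewrite ?inE.
Qed.

Lemma geometric_graph_mono (p : \bar R) (r r' : R) (n : nat) (x : 'I_n -> plane R) :
  r <= r' -> subrel (geometric_graph p r x) (geometric_graph p r' x).
Proof. by move=> rr i j /andP[ij h]; rewrite /geometric_graph ij (le_trans h). Qed.

End SharpThreshold.

Theorem theorem1 (R : realType) (p : \bar R) (hp : (1 <= p)%E)
    (d : nat -> measure_display) (T : forall n, measurableType (d n))
    (P : forall n, probability (T n) R)
    (X : forall n, 'I_n -> {RV (P n) >-> plane R})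
    (hX : forall n, iid_uniform_points (@X n)) :
  let G (r : R) (n : nat) (w : T n) : rel 'I_n :=
    geometric_graph p r (fun i => X n i w) in
  [/\ forall eps : R, 0 < eps ->
        aas P (fun n =>
          [set w | ~ hamiltonian (G (rgg_radius (lp_ball_area p + eps) n) n w)]),
      forall eps : R, 0 < eps -> eps < lp_ball_area p ->
        aas P (fun n =>
          [set w | hamiltonian (G (rgg_radius (lp_ball_area p - eps) n) n w)])
    & sharp_threshold P G (fun n => @hamiltonian 'I_n)
        (rgg_radius (lp_ball_area p))].
Proof.
move=> G; have alpha0 := lp_ball_area_gt0 hp.
have mham (r : nat -> R) n : measurable [set w | hamiltonian (G (r n) n w)].
  exact: measurable_hamiltonian.
have mnham (r : nat -> R) n : measurable [set w | ~ hamiltonian (G (r n) n w)].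
  exact: measurableC (mham r n).
split=> [eps eps0|eps eps0 eps1|delta r delta0]; first 1 last.
- by apply: supercritical_hamiltonian => //; lra.
- split=> hr.
    (* For delta >= 1 the factor 1 - delta is not positive; capping delta at 1/2 keeps [c] positive
       and only enlarges the radius of comparison. *)
    pose c : R := 1 - Num.min delta (1 / 2).
    have c0 : 0 < c by rewrite subr_gt0 gt_min; apply/orP; right; lra.
    have c1 : c < 1 by rewrite ltrBlDr ltrDl lt_min delta0; lra.
    have hc : lp_ball_area p < lp_ball_area p / c ^+ 2.
      rewrite ltr_pdivlMr ?exprn_gt0 // -[ltRHS]mulr1 ltr_pM2l //.
      by rewrite exprn_ilt1 // ltW.
    have := subcritical_not_hamiltonian hp hX hc;
      apply: (aas_mono (mnham (rgg_radius _)) (mnham r)).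
    apply: filterS hr => n hn w /= H ham; apply: H; apply: hamiltonian_mono ham.
    apply: geometric_graph_mono; rewrite rgg_radius_scale //.
    apply: (le_trans hn); apply: ler_wpM2r; first exact: sqrtr_ge0.
    by rewrite lerB // ge_min lexx.
  pose c : R := 1 + delta.
  have c0 : 0 < c by rewrite /c; lra.
  have hc : lp_ball_area p / c ^+ 2 < lp_ball_area p.
    rewrite ltr_pdivrMr ?exprn_gt0 // -[ltLHS]mulr1 ltr_pM2l //.
    by rewrite exprn_egt1 // /c; lra.
  have hc0 : 0 < lp_ball_area p / c ^+ 2 by rewrite divr_gt0 // exprn_gt0.
  have := supercritical_hamiltonian hp hX hc0 hc;
    apply: (aas_mono (mham (rgg_radius _)) (mham r)).
  apply: filterS hr => n hn w /=; apply: hamiltonian_mono.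
  by apply: geometric_graph_mono; rewrite rgg_radius_scale.
- by apply: subcritical_not_hamiltonian => //; lra.
Qed.
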